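(* Let $0\le\rho\le\eta<1$, $m\in\mathbb{N}$, $n\in\mathbb{N}_0$, $m>n$. Let $f_m(z)=z-\sum_{k=2}^{\infty}|a_k|z^k+(-1)^{m-1}\sum_{k=1}^{\infty}|b_k|\overline{z}^k\in\overline{S}H(m,n,\eta)$ and $F_m(z)=z-\sum_{k=2}^{\infty}|A_k|z^k+(-1)^{m-1}\sum_{k=1}^{\infty}|B_k|\overline{z}^k\in\overline{S}H(m,n,\rho)$. Then the convolution $$(f_m*F_m)(z)=z-\sum_{k=2}^{\infty}|a_k||A_k|z^k+(-1)^{m-1}\sum_{k=1}^{\infty}|b_k||B_k|\overline{z}^k$$ belongs to $\overline{S}H(m,n,\eta)$, and $\overline{S}H(m,n,\eta)\subset\overline{S}H(m,n,\rho)$.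
   Context: Fix real parameters $\alpha,\beta,\gamma,\delta>0$ and $p,q>0$ with $q\le \alpha+p$. For an integer $m\ge 0$ define $C_1(m)=1$ and, for $k\ge 2$, $$C_k(m)=\frac{(m+1)_{k-1}}{(k-1)!}\cdot\frac{\Gamma(\gamma+q(k-1))/\Gamma(\gamma)}{\Gamma(\beta+\alpha(k-1))\,\Gamma(\delta+p(k-1))/\Gamma(\delta)},$$ where $(x)_j=\Gamma(x+j)/\Gamma(x)$. For analytic $\varphi(z)=\sum_{k\ge1}c_kz^k$ on $U=\{|z|<1\}$ set $\Phi^m\varphi(z)=\sum_{k\ge1}C_k(m)c_kz^k$, and for harmonic $f=h+\overline{g}$ set $\Phi^m f=\Phi^m h+(-1)^m\overline{\Phi^m g}$. For $0\le\eta<1$ the class $SH(m,n,\eta)$ consists of harmonic $f=h+\overline g$, univalent and sense-preserving in $U$, with $h(z)=z+\sum_{k\ge2}a_kz^k$, $g(z)=\sum_{k\ge1}b_kz^k$, $|b_1|<1$, and $\operatorname{Re}\bigl(\Phi^m f/\Phi^n f\bigr)>\eta$ in $U$. The class $\overline{S}H(m,n,\eta)$ consists of those $f_m=h+\overline{g_m}\in SH(m,n,\eta)$ with $h(z)=z-\sum_{k\ge2}a_kz^k$, $g_m(z)=(-1)^{m-1}\sum_{k\ge1}b_kz^k$, $a_k,b_k\ge0$. *)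

(* Defs.v *)
From Stdlib Require Import Reals Arith Factorial.
From Coquelicot Require Import Coquelicot.
Open Scope R_scope.

Definition Gamma (x : R) : R :=
  RInt_gen (fun t => Rpower t (x - 1) * exp (- t)) (at_right 0) (Rbar_locally p_infty).

Definition poch (x : R) (j : nat) : R := Gamma (x + INR j) / Gamma x.

Definition Ck (al be ga de p q : R) (m k : nat) : R :=
  if (k <=? 1)%nat then 1 else
  let j := (k - 1)%nat in
  poch (INR m + 1) j / INR (fact j) *
  ((Gamma (ga + q * INR j) / Gamma ga) /
   (Gamma (be + al * INR j) * Gamma (de + p * INR j) / Gamma de)).

Definition Cseries (s : nat -> C) : C :=
  (Series (fun k => Re (s k)), Series (fun k => Im (s k))).

Definition psum (s : nat -> C) (z : C) : C := Cseries (fun k => (s k * Cpow z k)%C).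

(* Full coefficient sequence of h(z) = z + sum_{k>=2} hc_k z^k. *)
Definition hseq (hc : nat -> C) (k : nat) : C :=
  if (k =? 1)%nat then 1 else if (2 <=? k)%nat then hc k else 0.

(* Full coefficient sequence of g(z) = sum_{k>=1} gc_k z^k. *)
Definition gseq (gc : nat -> C) (k : nat) : C :=
  if (1 <=? k)%nat then gc k else 0.

Definition PhiSeq (al be ga de p q : R) (m : nat) (s : nat -> C) (k : nat) : C :=
  (RtoC (Ck al be ga de p q m k) * s k)%C.

Definition Phi (al be ga de p q : R) (m : nat) (hc gc : nat -> C) (z : C) : C :=
  (psum (PhiSeq al be ga de p q m (hseq hc)) z
  + RtoC ((-1) ^ m) * Cconj (psum (PhiSeq al be ga de p q m (gseq gc)) z))%C.

Definition harm (hc gc : nat -> C) (z : C) : C :=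
  (psum (hseq hc) z + Cconj (psum (gseq gc) z))%C.

Definition inU (z : C) : Prop := Cmod z < 1.

Definition SH (al be ga de p q : R) (m n : nat) (eta : R) (hc gc : nat -> C) : Prop :=
  (* h and g analytic in U (power series converging in U) *)
  (forall z, inU z -> ex_series (fun k => (hseq hc k * Cpow z k)%C)
                   /\ ex_series (fun k => (gseq gc k * Cpow z k)%C)) /\
  (* Phi^m f and Phi^n f are defined in U *)
  (forall z, inU z ->
     ex_series (fun k => (PhiSeq al be ga de p q m (hseq hc) k * Cpow z k)%C) /\
     ex_series (fun k => (PhiSeq al be ga de p q m (gseq gc) k * Cpow z k)%C) /\
     ex_series (fun k => (PhiSeq al be ga de p q n (hseq hc) k * Cpow z k)%C) /\
     ex_series (fun k => (PhiSeq al be ga de p q n (gseq gc) k * Cpow z k)%C)) /\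
  (forall z w, inU z -> inU w -> harm hc gc z = harm hc gc w -> z = w) /\
  (* sense-preserving in U: |g'(z)| < |h'(z)| *)
  (forall z, inU z -> exists dh dg : C,
     is_derive (psum (hseq hc)) z dh /\ is_derive (psum (gseq gc)) z dg /\
     Cmod dg < Cmod dh) /\
  Cmod (gc 1%nat) < 1 /\
  (forall z, inU z -> z <> 0 ->
     eta < Re (Phi al be ga de p q m hc gc z / Phi al be ga de p q n hc gc z)%C).

Definition SHbar (al be ga de p q : R) (m n : nat) (eta : R) (a b : nat -> R) : Prop :=
  (forall k, (2 <= k)%nat -> 0 <= a k) /\
  (forall k, (1 <= k)%nat -> 0 <= b k) /\
  SH al be ga de p q m n eta (fun k => RtoC (- a k))
     (fun k => RtoC ((-1) ^ (m - 1) * b k)).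

(* Main.v *)
(** Restricting the sense-preserving condition to the real axis gives
    [sum k (a_k + b_k) r^(k-1) < 1] for [0 <= r < 1], since [h'] is real there,
    nonzero, and equal to [1] at [0]; conversely this inequality implies both that
    [f] is sense-preserving and that it is univalent. Likewise the condition
    [Re (Phi^m f / Phi^n f) > eta] on the real axis is a linear inequality in the
    coefficients, and, as [0 < C_k(n) <= C_k(m)], that inequality gives the condition
    on all of [U]. So the class is described by linear inequalities that are
    monotone in the coefficients. The first one bounds the coefficients of [F_m]
    by [1], hence those of the convolution by those of [f_m]. The bound [A_k <= 1]
    cannot be read off the inequality for [Re (Phi^m F / Phi^n F)], because [C_k(m)]
    may be less than [1]. *)

Require Import Defs.
From Stdlib Require Import Reals Lra Lia Classical.
From Coquelicot Require Import Coquelicot.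
Open Scope R_scope.

(** * The Gamma function *)

(** [Gamma] is an improper integral, so [0 < C_k(n) <= C_k(m)] rests on its convergence, its
    positivity and [Gamma (x + 1) = x * Gamma x]. Only the Pochhammer factor of [C_k(m)] depends on
    [m].

    The linear inequalities are kept as strict inequalities between power series at each radius
    [r < 1], without passing to [r = 1]: at a point [z] of [U] exactly the one at [r = |z|] is used.
    It carries over from the real axis to [z] because every series to be estimated has nonnegative
    coefficients, so its modulus at [z] is at most its value at [|z|]. For the quotient [N / D] this
    applies after [Re (N / D) > eta] is rewritten as [|N - D| < |N + (1 - 2 eta) D|], where
    [C_k(n) <= C_k(m)] makes the coefficients nonnegative.

    As [m] and [m - 1] have opposite parity, the antianalytic part of [Phi^m f] always carries the
    sign [-1]. In [Phi^n f] the sign depends on the parities of [n] and [m], so the estimates are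
    made for any real [sg] with [|sg| <= 1].

    Univalence holds because [f(z) - z] is a contraction on every disk of radius less than [1]. *)

Lemma is_RInt_gen_lub (f : R -> R) (M : R) :
  (forall t, 0 < t -> continuous f t) ->
  (forall t, 0 < t -> 0 <= f t) ->
  (forall u v, 0 < u -> u <= v -> RInt f u v <= M) ->
  exists L, is_RInt_gen f (at_right 0) (Rbar_locally p_infty) L /\
    forall u v, 0 < u -> u <= v -> RInt f u v <= L.
Proof.
intros fC f0 fM.
assert (fI : forall u v, 0 < u -> u <= v -> ex_RInt f u v).
{ intros u v u0 uv; apply (ex_RInt_continuous (V := R_CompleteNormedModule)).
  intros z Hz; apply fC; rewrite Rmin_left in Hz by lra; lra. }
destruct (completeness (fun y => exists u v, 0 < u /\ u <= v /\ y = RInt f u v))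
  as [L [ub lub]].
{ exists M; intros y (u & v & u0 & uv & ->); auto. }
{ exists (RInt f 1 1), 1, 1; repeat split; lra. }
assert (fL : forall u v, 0 < u -> u <= v -> RInt f u v <= L).
{ intros u v u0 uv; apply ub; exists u, v; auto. }
exists L; split; [|exact fL].
intros P [eps HP].
(* An interval whose integral exceeds [L - eps]; as [f] is nonnegative, every larger interval then
   has its integral in [(L - eps, L]]. *)
destruct (classic (exists u v, 0 < u /\ u <= v /\ L - eps < RInt f u v))
  as [(u & v & u0 & uv & H)|H].
2:{ exfalso.
  assert (L <= L - eps).
  { apply lub; intros y (u & v & u0 & uv & ->); apply Rnot_lt_le; intro.
    apply H; exists u, v; auto. }
  generalize (cond_pos eps); lra. }
exists (fun x => 0 < x < u) (fun y => v < y).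
{ exists (mkposreal u u0); intros y Hy y0; split; auto.
  change (Rabs (y - 0) < u) in Hy; rewrite Rminus_0_r in Hy.
  apply Rabs_def2 in Hy; lra. }
{ exists v; auto. }
intros x y Hx Hy; exists (RInt f x y); split; simpl.
{ apply (RInt_correct (V := R_CompleteNormedModule)); apply fI; lra. }
apply HP.
assert (E : RInt f x y = RInt f x u + RInt f u v + RInt f v y).
{ generalize (RInt_Chasles f x u v ltac:(apply fI; lra) ltac:(apply fI; lra)).
  generalize (RInt_Chasles f x v y ltac:(apply fI; lra) ltac:(apply fI; lra)).
  unfold plus; simpl; lra. }
assert (0 <= RInt f x u) by (apply RInt_ge_0; [lra|apply fI; lra|intros; apply f0; lra]).
assert (0 <= RInt f v y) by (apply RInt_ge_0; [lra|apply fI; lra|intros; apply f0; lra]).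
assert (RInt f x y <= L) by (apply fL; lra).
change (Rabs (RInt f x y - L) < eps).
apply Rabs_def1; lra.
Qed.

Lemma exp_increasing_le (x y : R) : x <= y -> exp x <= exp y.
Proof. intros [H| ->]; [apply Rlt_le, exp_increasing, H|apply Rle_refl]. Qed.

(** The maximum over [t] is at [t = y]; the inequality [ln s <= s - 1] at [s = t / y] gives it, and
    the factor [exp (- y)] is dropped. *)
Lemma Rpower_exp_le (y t : R) : 0 < y -> 0 < t -> Rpower t y * exp (- t) <= Rpower y y.
Proof.
intros y0 t0; unfold Rpower; rewrite <- exp_plus.
apply exp_increasing_le.
assert (H : ln (t / y) <= t / y - 1).
{ generalize (exp_ineq1_le (ln (t / y))); rewrite exp_ln by (apply Rdiv_lt_0_compat; lra); lra. }
rewrite ln_div in H by lra.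
apply (Rmult_le_compat_l y) in H; [|lra].
replace (y * (t / y - 1)) with (t - y) in H by (field; lra); nra.
Qed.

Lemma is_derive_Rpower (y t : R) :
  0 < t -> is_derive (fun s => Rpower s y) t (y * Rpower t (y - 1)).
Proof. intros t0; apply is_derive_Reals, derivable_pt_lim_power, t0. Qed.

Lemma continuous_Gamma_integrand (x t : R) :
  0 < t -> continuous (fun t => Rpower t (x - 1) * exp (- t)) t.
Proof.
intros t0; apply (continuous_mult (K := R_AbsRing)).
- apply (ex_derive_continuous (K := R_AbsRing) (V := R_NormedModule)).
  eexists; apply is_derive_Rpower, t0.
- apply (ex_derive_continuous (K := R_AbsRing) (V := R_NormedModule)).
  auto_derive; auto.
Qed.

Lemma Gamma_integrand_pos (x t : R) : 0 < Rpower t (x - 1) * exp (- t).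
Proof. apply Rmult_lt_0_compat; apply exp_pos. Qed.

(* [t^x / (1 + t^x)] is bounded, and its derivative
   [x t^(x-1) / (1 + t^x)^2] dominates the integrand of Gamma. *)
Lemma RInt_Gamma_le (x u v : R) : 0 < x -> 0 < u -> u <= v ->
  RInt (fun t => Rpower t (x - 1) * exp (- t)) u v
    <= (2 + 2 * Rpower (2 * x) (2 * x)) / x.
Proof.
intros x0 u0 uv.
(* [K] bounds [exp (- t) * (1 + t^x)^2]: the square is at most [2 + 2 t^(2x)], and
   [t^(2x) * exp (- t) <= (2x)^(2x)]. *)
set (K := 2 + 2 * Rpower (2 * x) (2 * x)).
assert (K0 : 0 < K).
{ unfold K; generalize (exp_pos (2 * x * ln (2 * x))); unfold Rpower; lra. }
(* Up to an additive constant, [K / x] times [t^x / (1 + t^x)]; its values lie between [- K / x] and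
   [0], which controls both ends of the half-line at once. *)
set (F := fun t => - (K / x / (1 + Rpower t x))).
set (dF := fun t => K * Rpower t (x - 1) / (1 + Rpower t x) ^ 2).
assert (P0 : forall t, 0 < Rpower t x) by (intro; apply exp_pos).
assert (HF : is_RInt dF u v (minus (F v) (F u))).
{ assert (dd : forall t, 0 < t -> is_derive (fun s => Rpower s x) t (x * Rpower t (x - 1)))
    by (intros; apply is_derive_Rpower; auto).
  apply (is_RInt_derive (V := R_CompleteNormedModule));
    rewrite Rmin_left, Rmax_right by lra; intros t Ht.
  - unfold F, dF; specialize (P0 t).
    evar_last.
    + apply (is_derive_opp (K := R_AbsRing) (V := R_NormedModule)).
      apply (is_derive_scal (fun t => / (1 + Rpower t x)) t (K / x)).
      apply is_derive_inv; [|lra].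
      apply (is_derive_plus (K := R_AbsRing) (V := R_NormedModule)).
      * apply is_derive_const.
      * apply dd; lra.
    + unfold opp, plus, zero, scal; simpl; unfold mult; simpl; field; lra.
  - unfold dF; specialize (P0 t).
    apply (continuous_mult (K := R_AbsRing)).
    + apply (continuous_mult (K := R_AbsRing)); [apply continuous_const|].
      apply (ex_derive_continuous (K := R_AbsRing) (V := R_NormedModule)).
      eexists; apply is_derive_Rpower; lra.
    + apply (ex_derive_continuous (K := R_AbsRing) (V := R_NormedModule)).
      eexists; apply is_derive_inv; [|apply pow_nonzero; lra].
      apply is_derive_pow.
      apply (is_derive_plus (K := R_AbsRing) (V := R_NormedModule)).
      * apply is_derive_const.
      * apply dd; lra. }
apply Rle_trans with (minus (F v) (F u)).
- apply is_RInt_le with (fun t => Rpower t (x - 1) * exp (- t)) dF u v; auto.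
  { apply (RInt_correct (V := R_CompleteNormedModule)).
    apply (ex_RInt_continuous (V := R_CompleteNormedModule)).
    intros z Hz; apply continuous_Gamma_integrand; rewrite Rmin_left in Hz; lra. }
  intros t Ht; unfold dF; specialize (P0 t).
  assert (E := exp_pos (- t)).
  assert (H1 : exp (- t) <= 1) by (rewrite <- exp_0; apply exp_increasing_le; lra).
  assert (H2 : Rpower t x * Rpower t x * exp (- t) <= Rpower (2 * x) (2 * x)).
  { rewrite <- Rpower_plus; replace (x + x) with (2 * x) by ring.
    apply Rpower_exp_le; lra. }
  assert (H3 : exp (- t) * (1 + Rpower t x) ^ 2 <= K).
  { unfold K; generalize (Rle_0_sqr (1 - Rpower t x)); unfold Rsqr; nra. }
  assert (Q := exp_pos ((x - 1) * ln t)); fold (Rpower t (x - 1)) in Q.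
  apply Rmult_le_reg_r with ((1 + Rpower t x) ^ 2); [apply pow_lt; lra|].
  unfold Rdiv; rewrite (Rmult_assoc (K * _)), Rinv_l by (apply pow_nonzero; lra).
  nra.
- unfold minus, plus, opp, F; simpl.
  assert (Ku : 0 < K / x) by (apply Rdiv_lt_0_compat; lra).
  assert (0 < K / x / (1 + Rpower v x)).
  { apply Rdiv_lt_0_compat; auto; specialize (P0 v); lra. }
  assert (K / x / (1 + Rpower u x) <= K / x).
  { specialize (P0 u); apply Rmult_le_reg_r with (1 + Rpower u x); [lra|].
    unfold Rdiv at 1; rewrite Rmult_assoc, Rinv_l by lra; nra. }
  lra.
Qed.

Lemma Gamma_unique (x L : R) :
  is_RInt_gen (fun t => Rpower t (x - 1) * exp (- t)) (at_right 0)
    (Rbar_locally p_infty) L -> Gamma x = L.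
Proof.
intros H; unfold Gamma.
exact (is_RInt_gen_unique (V := R_CompleteNormedModule) _ L H).
Qed.

Lemma is_RInt_gen_Gamma (x : R) : 0 < x ->
  is_RInt_gen (fun t => Rpower t (x - 1) * exp (- t)) (at_right 0)
    (Rbar_locally p_infty) (Gamma x) /\ 0 < Gamma x.
Proof.
intros x0.
destruct (is_RInt_gen_lub (fun t => Rpower t (x - 1) * exp (- t))
  ((2 + 2 * Rpower (2 * x) (2 * x)) / x)) as (L & HL & LL).
- intros; apply continuous_Gamma_integrand; auto.
- intros; apply Rlt_le, Gamma_integrand_pos.
- intros; apply RInt_Gamma_le; auto.
- assert (E : Gamma x = L).
  { apply Gamma_unique, HL. }
  rewrite E; split; auto.
  apply Rlt_le_trans with (2 := LL 1 2 ltac:(lra) ltac:(lra)).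
  apply RInt_gt_0; [lra| |]; intros.
  + apply Gamma_integrand_pos.
  + apply continuous_Gamma_integrand; lra.
Qed.

Lemma Gamma_pos (x : R) : 0 < x -> 0 < Gamma x.
Proof. apply is_RInt_gen_Gamma. Qed.

Lemma filterlim_Rpower_exp_0 (x : R) : 0 < x ->
  filterlim (fun t => Rpower t x * exp (- t)) (at_right 0) (locally 0).
Proof.
intros x0 P [eps HP].
(* The radius is [eps] to the power [1 / x], so that [t^x < eps]. *)
exists (mkposreal (exp (ln eps / x)) (exp_pos _)); intros t Ht t0; apply HP.
change (Rabs (t - 0) < exp (ln eps / x)) in Ht.
change (Rabs (Rpower t x * exp (- t) - 0) < eps).
rewrite Rminus_0_r in *.
rewrite Rabs_pos_eq in Ht by lra.
rewrite Rabs_pos_eq by (apply Rlt_le, Rmult_lt_0_compat; apply exp_pos).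
apply ln_increasing in Ht; auto; rewrite ln_exp in Ht.
apply Rlt_trans with (Rpower t x).
- assert (exp (- t) < 1) by (rewrite <- exp_0; apply exp_increasing; lra).
  generalize (exp_pos (x * ln t)); fold (Rpower t x); nra.
- rewrite <- (exp_ln eps) by apply cond_pos.
  apply exp_increasing; apply (Rmult_lt_compat_l x) in Ht; auto.
  replace (x * (ln eps / x)) with (ln eps) in Ht by (field; lra); auto.
Qed.

Lemma filterlim_Rpower_exp_p (x : R) : 0 < x ->
  filterlim (fun t => Rpower t x * exp (- t)) (Rbar_locally p_infty) (locally 0).
Proof.
intros x0 P [eps HP].
(* From [t^(x+1) * exp (- t) <= (x+1)^(x+1)], divided by [t]. *)
exists (Rmax 0 (Rpower (x + 1) (x + 1) / eps)); intros t Ht; apply HP.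
assert (t0 := Rle_lt_trans _ _ _ (Rmax_l _ _) Ht).
assert (Ht' := Rle_lt_trans _ _ _ (Rmax_r _ _) Ht).
change (Rabs (Rpower t x * exp (- t) - 0) < eps).
rewrite Rminus_0_r, Rabs_pos_eq by (apply Rlt_le, Rmult_lt_0_compat; apply exp_pos).
assert (H := Rpower_exp_le (x + 1) t ltac:(lra) t0).
rewrite Rpower_plus, Rpower_1 in H by auto.
apply Rmult_lt_reg_r with t; auto.
assert (e0 := cond_pos eps).
apply (Rmult_lt_compat_l eps) in Ht'; auto.
replace (eps * (Rpower (x + 1) (x + 1) / eps)) with (Rpower (x + 1) (x + 1)) in Ht'
  by (field; lra).
nra.
Qed.

(** Integration by parts: the derivative of [t^x * exp (- t)] is the difference of the two
    integrands, and its boundary values at [0] and at infinity vanish. *)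
Lemma Gamma_succ (x : R) : 0 < x -> Gamma (x + 1) = x * Gamma x.
Proof.
intros x0.
assert (D : forall t, 0 < t -> Derive (fun s => Rpower s x * exp (- s)) t =
  x * (Rpower t (x - 1) * exp (- t)) - Rpower t (x + 1 - 1) * exp (- t)).
{ intros t t0; apply is_derive_unique; evar_last.
  - apply (is_derive_mult (fun s => Rpower s x) (fun s => exp (- s)) t
      (x * Rpower t (x - 1)) (- exp (- t))).
    + apply is_derive_Rpower, t0.
    + auto_derive; auto; ring.
    + intros; apply Rmult_comm.
  - unfold plus, mult; simpl; replace (x + 1 - 1) with x by ring; ring. }
assert (I : is_RInt_gen (Derive (fun s => Rpower s x * exp (- s))) (at_right 0)
  (Rbar_locally p_infty) (0 - 0)).
{ apply is_RInt_gen_Derive.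
  - exists (fun u => 0 < u) (fun v => 0 < v); [exists posreal_one; auto|exists 0; auto|].
    intros u v u0 v0 t Ht; simpl in Ht.
    assert (t0 : 0 < t) by (generalize (Rmin_glb_lt u v 0 u0 v0); lra).
    apply (ex_derive_mult (fun s => Rpower s x) (fun s => exp (- s)));
      [eexists; apply is_derive_Rpower, t0|auto_derive; auto].
  - exists (fun u => 0 < u) (fun v => 0 < v); [exists posreal_one; auto|exists 0; auto|].
    intros u v u0 v0 t Ht; simpl in Ht.
    assert (t0 : 0 < t) by (generalize (Rmin_glb_lt u v 0 u0 v0); lra).
    (* The formula [D] is valid for positive arguments only, hence the ball of radius [t] around
       [t]. *)
    eapply continuous_ext_loc.
    + exists (mkposreal t t0); intros s Hs; symmetry; apply D.
      change (Rabs (s - t) < t) in Hs; apply Rabs_def2 in Hs; lra.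
    + apply (continuous_minus (V := R_NormedModule)
        (fun t => x * (Rpower t (x - 1) * exp (- t)))).
      * apply (continuous_mult (K := R_AbsRing)); [apply continuous_const|].
        apply continuous_Gamma_integrand, t0.
      * apply continuous_Gamma_integrand, t0.
  - apply filterlim_Rpower_exp_0, x0.
  - apply filterlim_Rpower_exp_p, x0. }
destruct (is_RInt_gen_Gamma x x0) as [Ix _].
apply (is_RInt_gen_scal _ x) in Ix.
assert (J := is_RInt_gen_minus _ _ _ _ Ix I).
apply Gamma_unique.
replace (x * Gamma x) with (minus (scal x (Gamma x)) (0 - 0))
  by (unfold minus, plus, opp, scal; simpl; unfold mult; simpl; ring).
eapply is_RInt_gen_ext; [|exact J].
exists (fun u => 0 < u) (fun v => 0 < v); [exists posreal_one; auto|exists 0; auto|].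
intros u v u0 v0 t Ht; simpl in Ht.
rewrite D by (generalize (Rmin_glb_lt u v 0 u0 v0); lra).
unfold minus, plus, opp, scal; simpl; unfold mult; simpl; ring.
Qed.

(** * Positivity and monotonicity of the weights [C_k(m)] *)

Lemma Ck_pos (al be ga de p q : R) (m k : nat) :
  0 < al -> 0 < be -> 0 < ga -> 0 < de -> 0 < p -> 0 < q ->
  0 < Ck al be ga de p q m k.
Proof.
intros al0 be0 ga0 de0 p0 q0; unfold Ck, poch.
destruct (k <=? 1)%nat; [lra|].
assert (j0 := pos_INR (k - 1)); assert (m0 := pos_INR m).
assert (f0 := INR_fact_lt_0 (k - 1)).
repeat first [apply Rinv_0_lt_compat | apply Rmult_lt_0_compat | apply Gamma_pos];
  auto; nra.
Qed.

(** By the functional equation of [Gamma], the right side is the left side times [(x + j) / x]. *)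
Lemma poch_succ_le (x : R) (j : nat) : 0 < x -> poch x j <= poch (x + 1) j.
Proof.
intros x0; unfold poch; assert (j0 := pos_INR j).
replace (x + 1 + INR j) with (x + INR j + 1) by ring.
rewrite !Gamma_succ by lra.
assert (G := Gamma_pos x x0); assert (G' := Gamma_pos (x + INR j) ltac:(lra)).
assert (0 < x * Gamma x) by nra.
apply Rmult_le_reg_r with (x * Gamma x); auto.
unfold Rdiv; rewrite (Rmult_assoc _ (/ (x * _))), Rinv_l by lra.
replace (Gamma (x + INR j) * / Gamma x * (x * Gamma x)) with (x * Gamma (x + INR j))
  by (field; lra).
nra.
Qed.

Lemma Ck_le (al be ga de p q : R) (n m k : nat) :
  0 < al -> 0 < be -> 0 < ga -> 0 < de -> 0 < p -> 0 < q -> (n <= m)%nat ->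
  Ck al be ga de p q n k <= Ck al be ga de p q m k.
Proof.
intros al0 be0 ga0 de0 p0 q0 nm; unfold Ck.
destruct (k <=? 1)%nat; [lra|].
assert (j0 := pos_INR (k - 1)).
apply Rmult_le_compat_r.
{ apply Rlt_le.
  repeat first [apply Rinv_0_lt_compat | apply Rmult_lt_0_compat | apply Gamma_pos];
  auto; nra. }
apply Rmult_le_compat_r; [apply Rlt_le, Rinv_0_lt_compat, INR_fact_lt_0|].
induction nm; [lra|].
apply Rle_trans with (1 := IHnm); rewrite S_INR.
apply poch_succ_le; generalize (pos_INR m); lra.
Qed.
(** * Power series on the unit disk *)

(** Radius of convergence at least [1], phrased as absolute convergence: comparison of coefficients
    and termwise operations on [Cseries] use it in this form. *)
Definition disk_summable (c : nat -> R) : Prop :=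
  forall r, Rabs r < 1 -> CV_disk c r.

Lemma disk_summable_le (c d : nat -> R) :
  (forall k, Rabs (d k) <= Rabs (c k)) -> disk_summable c -> disk_summable d.
Proof.
intros dc Hc r Hr; apply (ex_series_le (V := R_CompleteNormedModule))
  with (fun k => Rabs (c k * r ^ k)); [|apply Hc, Hr].
intros k; change (Rabs (Rabs (d k * r ^ k)) <= Rabs (c k * r ^ k)).
rewrite Rabs_Rabsolu, !Rabs_mult.
apply Rmult_le_compat_r; [apply Rabs_pos|apply dc].
Qed.

Lemma disk_summable_Rabs (c : nat -> R) :
  disk_summable c -> disk_summable (fun k => Rabs (c k)).
Proof. apply disk_summable_le; intros; rewrite Rabs_Rabsolu; apply Rle_refl. Qed.

Lemma disk_summable_plus (c d : nat -> R) :
  disk_summable c -> disk_summable d -> disk_summable (fun k => c k + d k).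
Proof. intros Hc Hd r Hr; apply (CV_disk_plus c d); auto. Qed.

Lemma disk_summable_scal (x : R) (c : nat -> R) :
  disk_summable c -> disk_summable (fun k => x * c k).
Proof. intros Hc r Hr; apply (CV_disk_scal x c); auto. Qed.

Lemma disk_summable_minus (c d : nat -> R) :
  disk_summable c -> disk_summable d -> disk_summable (fun k => c k - d k).
Proof.
intros Hc Hd; apply disk_summable_le with (fun k => c k + (-1) * d k).
- intros; apply Req_le; f_equal; ring.
- apply disk_summable_plus; auto; apply disk_summable_scal; auto.
Qed.

Lemma CV_radius_ge_1 (c : nat -> R) :
  (forall r, 0 <= r < 1 -> ex_series (fun k => c k * r ^ k)) -> Rbar_le 1 (CV_radius c).
Proof.
intros Hc; destruct (CV_radius c) as [l| |] eqn:E; simpl; auto.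
- apply Rnot_lt_le; intros l1.
  (* A point of [[0, 1)] beyond the supposed radius [l]: the terms of the series do not tend to [0]
     there. *)
  set (r := (Rmax 0 l + 1) / 2).
  assert (Hr : 0 <= r < 1 /\ l < r).
  { unfold r; generalize (Rmax_l 0 l) (Rmax_r 0 l) (Rmax_lub_lt 0 l 1); lra. }
  apply (CV_disk_outside c r).
  + rewrite E, Rabs_pos_eq by lra; simpl; lra.
  + apply ex_series_lim_0, Hc; lra.
- generalize (CV_radius_ge_0 c); rewrite E; auto.
Qed.

Lemma disk_summable_ex_series (c : nat -> R) (r : R) :
  disk_summable c -> 0 <= r < 1 -> ex_series (fun k => c k * r ^ k).
Proof.
intros Hc Hr; apply ex_series_Rabs, Hc; rewrite Rabs_pos_eq; lra.
Qed.

Lemma disk_summable_radius (c : nat -> R) :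
  disk_summable c -> Rbar_le 1 (CV_radius c).
Proof. intros Hc; apply CV_radius_ge_1; auto using disk_summable_ex_series. Qed.

Lemma disk_summable_of_radius (c : nat -> R) :
  Rbar_le 1 (CV_radius c) -> disk_summable c.
Proof.
intros Hc r Hr; apply CV_disk_inside.
apply Rbar_lt_le_trans with 1; auto.
Qed.

Lemma disk_summable_derive (c : nat -> R) :
  disk_summable c -> disk_summable (PS_derive c).
Proof.
intros Hc; apply disk_summable_of_radius; rewrite CV_radius_derive.
apply disk_summable_radius, Hc.
Qed.

Lemma disk_summable_decr_1 (c : nat -> R) :
  disk_summable c -> disk_summable (PS_decr_1 c).
Proof.
intros Hc; apply disk_summable_of_radius; rewrite CV_radius_decr_1.
apply disk_summable_radius, Hc.
Qed.

Lemma PSeries_le (c d : nat -> R) (r : R) :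
  (forall k, 0 <= c k <= d k) -> disk_summable d -> 0 <= r < 1 ->
  PSeries c r <= PSeries d r.
Proof.
intros cd Hd Hr; apply Series_le; [|apply disk_summable_ex_series; auto].
intros k; assert (0 <= r ^ k) by (apply pow_le; lra).
destruct (cd k); split; [apply Rmult_le_pos|apply Rmult_le_compat_r]; auto.
Qed.

Lemma PSeries_nonneg (c : nat -> R) (r : R) :
  (forall k, 0 <= c k) -> disk_summable c -> 0 <= r < 1 -> 0 <= PSeries c r.
Proof.
intros c0 Hc Hr; rewrite <- (PSeries_const_0 r).
apply PSeries_le; auto; intros k; split; auto; lra.
Qed.

Lemma PSeries_plus_disk (c d : nat -> R) (r : R) :
  disk_summable c -> disk_summable d -> 0 <= r < 1 ->
  PSeries (fun k => c k + d k) r = PSeries c r + PSeries d r.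
Proof.
intros Hc Hd Hr; unfold PSeries.
rewrite <- Series_plus by (apply disk_summable_ex_series; auto).
apply Series_ext; intros; ring.
Qed.

Lemma PSeries_scal_fun (x : R) (c : nat -> R) (r : R) :
  PSeries (fun k => x * c k) r = x * PSeries c r.
Proof. apply PSeries_scal. Qed.

Lemma PSeries_minus_disk (c d : nat -> R) (r : R) :
  disk_summable c -> disk_summable d -> 0 <= r < 1 ->
  PSeries (fun k => c k - d k) r = PSeries c r - PSeries d r.
Proof.
intros Hc Hd Hr.
rewrite (PSeries_ext _ (fun k => c k + (-1) * d k)) by (intros; ring).
rewrite PSeries_plus_disk, PSeries_scal_fun; auto; [ring|].
apply disk_summable_scal; auto.
Qed.

(** A negative value would force a zero between [0] and [r], by the intermediate value theorem. *)
Lemma PSeries_pos_of_nonvanishing (c : nat -> R) :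
  disk_summable c -> 0 < c 0%nat ->
  (forall r, 0 < r < 1 -> PSeries c r <> 0) ->
  forall r, 0 <= r < 1 -> 0 < PSeries c r.
Proof.
intros Hc c0 nz r Hr.
destruct (Req_dec r 0) as [->|r0]; [rewrite PSeries_0; auto|].
apply Rnot_le_lt; intros [neg|E]; [|apply (nz r); lra].
assert (cont : forall x, 0 <= x < 1 -> continuity_pt (PSeries c) x).
{ intros x Hx; apply PSeries_continuity.
  apply Rbar_lt_le_trans with 1; [simpl; rewrite Rabs_pos_eq; lra|].
  apply disk_summable_radius, Hc. }
assert (lim : forall x, 0 <= x < 1 -> is_lim (PSeries c) x (PSeries c x)).
{ intros x Hx; apply is_lim_continuity, cont, Hx. }
destruct (IVT_Rbar_decr (PSeries c) 0 r (PSeries c 0) (PSeries c r) 0)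
  as (x & Hx1 & Hx2 & Hx3).
- apply lim; lra.
- apply lim; lra.
- simpl; intros; apply cont; lra.
- simpl; lra.
- rewrite PSeries_0; simpl; auto.
- simpl in *; apply (nz x); auto; lra.
Qed.

(** * Complex sums *)

Lemma ex_series_Re (u : nat -> C) :
  ex_series (fun k => Cmod (u k)) -> ex_series (fun k => Re (u k)).
Proof.
apply (ex_series_le (V := R_CompleteNormedModule)); intros k; apply re_le_Cmod.
Qed.

Lemma im_le_Cmod (z : C) : Rabs (Im z) <= Cmod z.
Proof. apply Rle_trans with (2 := Rmax_Cmod z), Rmax_r. Qed.

Lemma ex_series_Im (u : nat -> C) :
  ex_series (fun k => Cmod (u k)) -> ex_series (fun k => Im (u k)).
Proof.
apply (ex_series_le (V := R_CompleteNormedModule)); intros k; apply im_le_Cmod.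
Qed.

Lemma Cseries_plus (u v : nat -> C) :
  ex_series (fun k => Cmod (u k)) -> ex_series (fun k => Cmod (v k)) ->
  Cseries (fun k => u k + v k)%C = (Cseries u + Cseries v)%C.
Proof.
intros Hu Hv; unfold Cseries, Cplus; simpl; f_equal;
  apply Series_plus; auto using ex_series_Re, ex_series_Im.
Qed.

Lemma Cseries_scal (x : C) (u : nat -> C) :
  ex_series (fun k => Cmod (u k)) ->
  Cseries (fun k => x * u k)%C = (x * Cseries u)%C.
Proof.
intros Hu; assert (Hr := ex_series_Re u Hu); assert (Hi := ex_series_Im u Hu).
unfold Cseries, Cmult; simpl; f_equal.
- rewrite Series_minus, !Series_scal_l; auto;
    apply (ex_series_scal (V := R_NormedModule)); auto.
- rewrite Series_plus, !Series_scal_l; auto;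
    apply (ex_series_scal (V := R_NormedModule)); auto.
Qed.

Lemma Cseries_minus (u v : nat -> C) :
  ex_series (fun k => Cmod (u k)) -> ex_series (fun k => Cmod (v k)) ->
  Cseries (fun k => u k - v k)%C = (Cseries u - Cseries v)%C.
Proof.
intros Hu Hv; unfold Cseries, Cminus, Cplus, Copp; simpl; f_equal;
  apply Series_minus; auto using ex_series_Re, ex_series_Im.
Qed.

Lemma ex_series_Cmod_minus (u v : nat -> C) :
  ex_series (fun k => Cmod (u k)) -> ex_series (fun k => Cmod (v k)) ->
  ex_series (fun k => Cmod (u k - v k)).
Proof.
intros Hu Hv; apply (ex_series_le (V := R_CompleteNormedModule)) with
  (2 := ex_series_plus (V := R_NormedModule) _ _ Hu Hv).
intros k; change (Rabs (Cmod (u k - v k)) <= Cmod (u k) + Cmod (v k)).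
rewrite Rabs_pos_eq by apply Cmod_ge_0.
apply Rle_trans with (1 := Cmod_triangle _ _); rewrite Cmod_opp; lra.
Qed.

Lemma Cseries_ext (u v : nat -> C) :
  (forall k, u k = v k) -> Cseries u = Cseries v.
Proof. intros E; unfold Cseries; f_equal; apply Series_ext; intros; rewrite E; auto. Qed.

(* Pair the sum [S] with itself: [|S|^2 = sum Re (conj S * u k) <= |S| sum |u k|]. *)
Lemma Cmod_Cseries_le (u : nat -> C) :
  ex_series (fun k => Cmod (u k)) ->
  Cmod (Cseries u) <= Series (fun k => Cmod (u k)).
Proof.
intros Hu; assert (Hr := ex_series_Re u Hu); assert (Hi := ex_series_Im u Hu).
set (S := Cseries u).
assert (E : Cmod S * Cmod S = Series (fun k => Re (Cconj S * u k)%C)).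
{ rewrite (Series_ext _ (fun k => Re S * Re (u k) + Im S * Im (u k)))
    by (intros k; rewrite re_mult; unfold Cconj, Re, Im; simpl; ring).
  rewrite Series_plus by (apply (ex_series_scal (V := R_NormedModule)); auto).
  rewrite !Series_scal_l; replace (Cmod S * Cmod S) with (Cmod S ^ 2) by ring.
  rewrite Cmod2_alt; unfold S, Cseries, Re, Im; simpl; ring. }
assert (L : Cmod S * Cmod S <= Cmod S * Series (fun k => Cmod (u k))).
{ rewrite E, <- Series_scal_l.
  assert (T : forall k, Rabs (Re (Cconj S * u k)%C) <= Cmod S * Cmod (u k)).
  { intros k; rewrite <- (Cmod_conj S), <- Cmod_mult; apply re_le_Cmod. }
  assert (Hs : ex_series (fun k => Cmod S * Cmod (u k)))
    by (apply (ex_series_scal (V := R_NormedModule)); auto).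
  assert (Ha : ex_series (fun k => Rabs (Re (Cconj S * u k)%C))).
  { apply (ex_series_le (V := R_CompleteNormedModule)) with (2 := Hs).
    intros k; change (Rabs (Rabs (Re (Cconj S * u k)%C)) <= Cmod S * Cmod (u k)).
    rewrite Rabs_Rabsolu; auto. }
  apply Rle_trans with (1 := Rle_abs _), Rle_trans with (1 := Series_Rabs _ Ha).
  apply Series_le; auto; intros k; split; [apply Rabs_pos|auto]. }
destruct (Req_dec (Cmod S) 0) as [S0|S0].
- rewrite S0, <- (PSeries_const_0 1); apply Series_le; auto.
  intros; rewrite Rmult_0_l; split; [lra|apply Cmod_ge_0].
- apply Rmult_le_reg_l with (Cmod S); auto.
  generalize (Cmod_ge_0 S); lra.
Qed.

(** * Power series with real coefficients at complex points *)

Lemma psum_summable (c : nat -> R) (z : C) : disk_summable c -> inU z ->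
  ex_series (fun k => Cmod (RtoC (c k) * Cpow z k)).
Proof.
intros Hc Hz; apply ex_series_ext with (fun k => Rabs (c k * Cmod z ^ k)).
- intros k; rewrite Cmod_mult, Cmod_R, Cmod_pow, Rabs_mult; f_equal.
  apply Rabs_pos_eq, pow_le, Cmod_ge_0.
- apply Hc; rewrite Rabs_pos_eq; auto; apply Cmod_ge_0.
Qed.

Lemma psum_ex_series (c : nat -> R) (z : C) : disk_summable c -> inU z ->
  ex_series (fun k => RtoC (c k) * Cpow z k)%C.
Proof.
intros Hc Hz; apply (ex_series_le (V := C_CompleteNormedModule)) with
  (2 := psum_summable c z Hc Hz).
intros k; apply Rle_refl.
Qed.

(** Convergence at the real points of [[0, 1)] already determines the radius; there the real parts
    of the complex partial sums are the real partial sums. *)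
Lemma disk_summable_of_psum (c : nat -> R) :
  (forall z, inU z -> ex_series (fun k => RtoC (c k) * Cpow z k)%C) ->
  disk_summable c.
Proof.
intros H; apply disk_summable_of_radius, CV_radius_ge_1; intros r Hr.
destruct (H (RtoC r)) as [l Hl]; [unfold inU; rewrite Cmod_R, Rabs_pos_eq; lra|].
exists (Re l).
apply filterlim_ext with (fun n => Re (sum_n (fun k => RtoC (c k) * Cpow (RtoC r) k)%C n)).
- intros n; induction n as [|n IH].
  + rewrite !sum_O, <- RtoC_pow, <- RtoC_mult; auto.
  + rewrite !sum_Sn, <- IH, <- RtoC_pow, <- RtoC_mult; apply re_plus.
- apply filterlim_comp with (1 := Hl).
  intros P [eps HP]; exists eps; intros y [Hy _]; apply HP, Hy.
Qed.

Lemma Cmod_psum_le (c : nat -> R) (z : C) : disk_summable c -> inU z ->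
  Cmod (psum (fun k => RtoC (c k)) z) <= PSeries (fun k => Rabs (c k)) (Cmod z).
Proof.
intros Hc Hz; apply Rle_trans with (1 := Cmod_Cseries_le _ (psum_summable c z Hc Hz)).
apply Req_le, Series_ext; intros k.
rewrite Cmod_mult, Cmod_R, Cmod_pow; auto.
Qed.

Lemma psum_plus (c d : nat -> R) (z : C) :
  disk_summable c -> disk_summable d -> inU z ->
  psum (fun k => RtoC (c k + d k)) z =
  (psum (fun k => RtoC (c k)) z + psum (fun k => RtoC (d k)) z)%C.
Proof.
intros Hc Hd Hz; unfold psum; rewrite <- Cseries_plus by (apply psum_summable; auto).
apply Cseries_ext; intros; rewrite RtoC_plus; ring.
Qed.

Lemma psum_scal (x : R) (c : nat -> R) (z : C) :
  disk_summable c -> inU z ->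
  psum (fun k => RtoC (x * c k)) z = (x * psum (fun k => RtoC (c k)) z)%C.
Proof.
intros Hc Hz; unfold psum; rewrite <- Cseries_scal by (apply psum_summable; auto).
apply Cseries_ext; intros; rewrite RtoC_mult; ring.
Qed.

Lemma psum_minus (c d : nat -> R) (z : C) :
  disk_summable c -> disk_summable d -> inU z ->
  psum (fun k => RtoC (c k - d k)) z =
  (psum (fun k => RtoC (c k)) z - psum (fun k => RtoC (d k)) z)%C.
Proof.
intros Hc Hd Hz; unfold psum; rewrite <- Cseries_minus by (apply psum_summable; auto).
apply Cseries_ext; intros; rewrite RtoC_minus; ring.
Qed.

Lemma psum_real (c : nat -> R) (r : R) :
  psum (fun k => RtoC (c k)) (RtoC r) = RtoC (PSeries c r).
Proof.
change (RtoC (PSeries c r)) with (PSeries c r, 0).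
unfold psum, Cseries, PSeries; f_equal.
- apply Series_ext; intros; rewrite <- RtoC_pow, <- RtoC_mult; auto.
- rewrite (Series_ext _ (fun k => 0 * 0)); [rewrite Series_scal_l; ring|].
  intros; rewrite <- RtoC_pow, <- RtoC_mult; simpl; ring.
Qed.

Lemma psum_ext (s t : nat -> C) (z : C) : (forall k, s k = t k) -> psum s z = psum t z.
Proof. intros E; apply Cseries_ext; intros; rewrite E; auto. Qed.

(** * Lipschitz and Taylor estimates, complex derivative *)

Lemma Cmod_pow_sub_le (z w : C) (r : R) (k : nat) :
  Cmod z <= r -> Cmod w <= r ->
  Cmod (Cpow w (S k) - Cpow z (S k)) <= INR (S k) * r ^ k * Cmod (w - z).
Proof.
intros Hz Hw; assert (r0 := Rle_trans _ _ _ (Cmod_ge_0 z) Hz).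
assert (d0 := Cmod_ge_0 (w - z)).
induction k as [|k IH].
- rewrite !Cpow_1_r; simpl; lra.
- replace (Cpow w (S (S k)) - Cpow z (S (S k)))%C
    with (w * (Cpow w (S k) - Cpow z (S k)) + Cpow z (S k) * (w - z))%C
    by (rewrite !(Cpow_S _ (S k)); ring).
  apply Rle_trans with (1 := Cmod_triangle _ _); rewrite !Cmod_mult, Cmod_pow.
  assert (Cmod w * Cmod (Cpow w (S k) - Cpow z (S k))
    <= r * (INR (S k) * r ^ k * Cmod (w - z))).
  { apply Rmult_le_compat; auto using Cmod_ge_0. }
  assert (Cmod z ^ S k * Cmod (w - z) <= r ^ S k * Cmod (w - z)).
  { apply Rmult_le_compat_r; auto; apply pow_incr; split; auto; apply Cmod_ge_0. }
  rewrite (S_INR (S k)).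
  replace ((INR (S k) + 1) * r ^ S k * Cmod (w - z)) with
    (r * (INR (S k) * r ^ k * Cmod (w - z)) + r ^ S k * Cmod (w - z)) by (simpl; ring).
  lra.
Qed.

(** The factor [1/2] of Taylor's formula is given up, so that the constants are those of the second
    derivative and sum to [PS_derive (PS_derive _)]. *)
Lemma Cmod_pow_taylor_le (z w : C) (r : R) (k : nat) :
  Cmod z <= r -> Cmod w <= r ->
  Cmod (Cpow w (S (S k)) - Cpow z (S (S k))
        - RtoC (INR (S (S k))) * Cpow z (S k) * (w - z))
    <= INR (S k) * INR (S (S k)) * r ^ k * Cmod (w - z) ^ 2.
Proof.
intros Hz Hw; assert (r0 := Rle_trans _ _ _ (Cmod_ge_0 z) Hz).
assert (d0 := pow2_ge_0 (Cmod (w - z))).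
induction k as [|k IH].
- replace (Cpow w 2 - Cpow z 2 - RtoC (INR 2) * Cpow z 1 * (w - z))%C
    with ((w - z) * (w - z))%C
    by (rewrite !Cpow_S; simpl INR; rewrite RtoC_plus; simpl; ring).
  rewrite Cmod_mult; simpl INR; simpl pow; simpl pow in d0; lra.
- set (T := (Cpow w (S (S k)) - Cpow z (S (S k))
        - RtoC (INR (S (S k))) * Cpow z (S k) * (w - z))%C) in *.
  (* Recursion for the remainder: multiply the previous one by [w] and add a multiple of
     [(w - z)^2]. *)
  replace (Cpow w (S (S (S k))) - Cpow z (S (S (S k)))
        - RtoC (INR (S (S (S k)))) * Cpow z (S (S k)) * (w - z))%C
    with (w * T + RtoC (INR (S (S k))) * Cpow z (S k) * ((w - z) * (w - z)))%C
    by (unfold T; rewrite (S_INR (S (S k))), RtoC_plus,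
      !(Cpow_S _ (S (S k))), !(Cpow_S _ (S k)); ring).
  assert (n0 := pos_INR (S (S k))).
  apply Rle_trans with (1 := Cmod_triangle _ _); rewrite !Cmod_mult, Cmod_pow, Cmod_R.
  rewrite (Rabs_pos_eq (INR _)) by auto.
  assert (Cmod w * Cmod T <= r * (INR (S k) * INR (S (S k)) * r ^ k * Cmod (w - z) ^ 2)).
  { apply Rmult_le_compat; auto using Cmod_ge_0. }
  assert (INR (S (S k)) * Cmod z ^ S k * (Cmod (w - z) * Cmod (w - z))
    <= INR (S (S k)) * r ^ S k * Cmod (w - z) ^ 2).
  { replace (Cmod (w - z) ^ 2) with (Cmod (w - z) * Cmod (w - z)) in * by ring.
    apply Rmult_le_compat_r; auto; apply Rmult_le_compat_l; auto.
    apply pow_incr; split; auto; apply Cmod_ge_0. }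
  assert (0 <= INR (S (S k)) * r ^ S k * Cmod (w - z) ^ 2).
  { apply Rmult_le_pos; auto; apply Rmult_le_pos; auto; apply pow_le; auto. }
  replace (INR (S (S k)) * INR (S (S (S k))) * r ^ S k * Cmod (w - z) ^ 2) with
    (r * (INR (S k) * INR (S (S k)) * r ^ k * Cmod (w - z) ^ 2)
     + 2 * (INR (S (S k)) * r ^ S k * Cmod (w - z) ^ 2))
    by (rewrite !S_INR; simpl; ring).
  lra.
Qed.

Lemma Series_decr_1 (u : nat -> R) : u 0%nat = 0 -> ex_series u ->
  Series u = Series (fun k => u (S k)).
Proof. intros u0 Hu; rewrite (Series_incr_1 u Hu), u0; ring. Qed.

(** For nonnegative coefficients the constant is the derivative at [r] itself; this turns the
    inequality on the derivatives into a contraction. *)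
Lemma psum_lipschitz (c : nat -> R) (z w : C) (r : R) : disk_summable c ->
  Cmod z <= r -> Cmod w <= r -> r < 1 ->
  Cmod (psum (fun k => RtoC (c k)) w - psum (fun k => RtoC (c k)) z)
    <= PSeries (PS_derive (fun k => Rabs (c k))) r * Cmod (w - z).
Proof.
intros Hc Hz Hw r1; assert (r0 := Rle_trans _ _ _ (Cmod_ge_0 z) Hz).
assert (Sz := psum_summable c z Hc ltac:(unfold inU; lra)).
assert (Sw := psum_summable c w Hc ltac:(unfold inU; lra)).
unfold psum; rewrite <- Cseries_minus by auto.
set (u := fun k => (RtoC (c k) * Cpow w k - RtoC (c k) * Cpow z k)%C).
assert (Hu : ex_series (fun k => Cmod (u k))) by (apply ex_series_Cmod_minus; auto).
apply Rle_trans with (1 := Cmod_Cseries_le u Hu).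
rewrite Series_decr_1; auto.
2:{ unfold u; simpl; replace (_ - _)%C with (RtoC 0) by ring; apply Cmod_0. }
unfold PSeries; rewrite <- Series_scal_r.
apply Series_le.
2:{ apply (ex_series_scal_r (Cmod (w - z)) _), disk_summable_ex_series; try lra.
    apply disk_summable_derive, disk_summable_Rabs, Hc. }
intros k; split; [apply Cmod_ge_0|]; unfold u, PS_derive.
replace (_ - _)%C with (RtoC (c (S k)) * (Cpow w (S k) - Cpow z (S k)))%C by ring.
rewrite Cmod_mult, Cmod_R.
apply Rle_trans with (Rabs (c (S k)) * (INR (S k) * r ^ k * Cmod (w - z))).
- apply Rmult_le_compat_l; [apply Rabs_pos|apply Cmod_pow_sub_le; auto].
- apply Req_le; ring.
Qed.

Lemma psum_taylor (c : nat -> R) (z w : C) (r : R) : disk_summable c ->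
  Cmod z <= r -> Cmod w <= r -> r < 1 ->
  Cmod (psum (fun k => RtoC (c k)) w - psum (fun k => RtoC (c k)) z
        - (w - z) * psum (fun k => RtoC (PS_derive c k)) z)
    <= PSeries (PS_derive (PS_derive (fun k => Rabs (c k)))) r * Cmod (w - z) ^ 2.
Proof.
intros Hc Hz Hw r1; assert (r0 := Rle_trans _ _ _ (Cmod_ge_0 z) Hz).
assert (Sz := psum_summable c z Hc ltac:(unfold inU; lra)).
assert (Sw := psum_summable c w Hc ltac:(unfold inU; lra)).
assert (Sd := psum_summable _ z (disk_summable_derive c Hc) ltac:(unfold inU; lra)).
(* The derived series shifted by one, so that all sums run over the same index; the term at [0] is
   zero because of the factor [INR k]. *)
set (v := fun k => (RtoC (INR k * c k) * Cpow z (pred k))%C).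
assert (v0 : v 0%nat = RtoC 0) by (unfold v; simpl; rewrite Rmult_0_l; ring).
assert (Hv : ex_series (fun k => Cmod (v k))).
{ apply (ex_series_incr_1 (V := R_NormedModule)), Sd. }
assert (Ev : psum (fun k => RtoC (PS_derive c k)) z = Cseries v).
{ unfold psum, Cseries; f_equal; symmetry.
  - apply (Series_decr_1 (fun k => Re (v k))); [rewrite v0; auto|apply ex_series_Re, Hv].
  - apply (Series_decr_1 (fun k => Im (v k))); [rewrite v0; auto|apply ex_series_Im, Hv]. }
set (t := fun k => (RtoC (c k) * Cpow w k - RtoC (c k) * Cpow z k - (w - z) * v k)%C).
assert (Swz := ex_series_Cmod_minus _ _ Sw Sz).
assert (Hsv : ex_series (fun k => Cmod ((w - z) * v k))).
{ apply (ex_series_ext (V := R_NormedModule) (fun k => Cmod (w - z) * Cmod (v k)));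
    [intros; rewrite Cmod_mult; auto|].
  apply (ex_series_scal (V := R_NormedModule)), Hv. }
assert (Ht := ex_series_Cmod_minus _ _ Swz Hsv).
rewrite Ev; unfold psum; rewrite <- Cseries_scal, <- !Cseries_minus by auto.
apply Rle_trans with (1 := Cmod_Cseries_le t Ht).
assert (Ht1 : ex_series (fun k => Cmod (t (S k)))).
{ apply (ex_series_incr_1 (V := R_NormedModule) (fun k => Cmod (t k))), Ht. }
(* The remainders of the exponents [0] and [1] vanish, so the sum starts at exponent [2]. *)
rewrite Series_decr_1; auto.
2:{ unfold t; rewrite v0; simpl; replace (_ - _)%C with (RtoC 0) by ring; apply Cmod_0. }
rewrite Series_decr_1; auto.
2:{ unfold t, v; simpl; rewrite Rmult_1_l; replace (_ - _)%C with (RtoC 0) by ring.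
    apply Cmod_0. }
unfold PSeries; rewrite <- Series_scal_r.
apply Series_le.
2:{ apply (ex_series_scal_r (Cmod (w - z) ^ 2) _), disk_summable_ex_series; try lra.
    apply disk_summable_derive, disk_summable_derive, disk_summable_Rabs, Hc. }
intros k; split; [apply Cmod_ge_0|]; unfold t, v, PS_derive.
replace (_ - _)%C with (RtoC (c (S (S k))) * (Cpow w (S (S k)) - Cpow z (S (S k))
  - RtoC (INR (S (S k))) * Cpow z (S k) * (w - z)))%C
  by (rewrite RtoC_mult; simpl pred; ring).
rewrite Cmod_mult, Cmod_R.
apply Rle_trans with (Rabs (c (S (S k))) *
  (INR (S k) * INR (S (S k)) * r ^ k * Cmod (w - z) ^ 2)).
- apply Rmult_le_compat_l; [apply Rabs_pos|apply Cmod_pow_taylor_le; auto].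
- apply Req_le; ring.
Qed.

Lemma is_derive_psum (c : nat -> R) (z : C) : disk_summable c -> inU z ->
  is_derive (K := C_AbsRing) (V := C_NormedModule) (psum (fun k => RtoC (c k))) z
    (psum (fun k => RtoC (PS_derive c k)) z).
Proof.
intros Hc Hz; split; [apply is_linear_scal_l|].
intros x Hx; apply (is_filter_lim_locally_unique (V := AbsRing_NormedModule C_AbsRing)) in Hx.
subst x; intros eps.
unfold inU in Hz; set (r := (1 + Cmod z) / 2).
assert (z0 := Cmod_ge_0 z).
set (M := PSeries (PS_derive (PS_derive (fun k => Rabs (c k)))) r).
assert (M0 : 0 <= M).
{ apply PSeries_nonneg; [|apply disk_summable_derive, disk_summable_derive,
    disk_summable_Rabs, Hc|unfold r; lra].
  intros k; unfold PS_derive; apply Rmult_le_pos; [apply pos_INR|].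
  apply Rmult_le_pos; [apply pos_INR|apply Rabs_pos]. }
assert (e0 := cond_pos eps).
(* The first bound keeps [w] in the disk of radius [r], halfway between [|z|] and [1]; the second
   makes [M * |w - z| <= eps], with [M + 1] as a nonzero divisor. *)
assert (d0 : 0 < Rmin ((1 - Cmod z) / 2) (eps / (M + 1))).
{ apply Rmin_glb_lt; [lra|apply Rdiv_lt_0_compat; lra]. }
exists (mkposreal _ d0); intros w D.
change (Cmod (w - z) < Rmin ((1 - Cmod z) / 2) (eps / (M + 1))) in D.
assert (D1 := Rlt_le_trans _ _ _ D (Rmin_l _ _)).
assert (D2 : (M + 1) * Cmod (w - z) <= eps).
{ apply Rle_trans with ((M + 1) * (eps / (M + 1))).
  - apply Rmult_le_compat_l, Rlt_le, Rlt_le_trans with (1 := D), Rmin_r; lra.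
  - apply Req_le; field; lra. }
assert (Hw : Cmod w <= r).
{ replace w with (z + (w - z))%C by ring.
  apply Rle_trans with (1 := Cmod_triangle _ _); unfold r; lra. }
assert (T := psum_taylor c z w r Hc ltac:(unfold r; lra) Hw ltac:(unfold r; lra)).
fold M in T; apply Rle_trans with (1 := T).
change (M * Cmod (w - z) ^ 2 <= eps * Cmod (w - z)).
assert (q0 := Cmod_ge_0 (w - z)); nra.
Qed.

Lemma psum_incr_1 (c : nat -> R) (z : C) : disk_summable c -> inU z ->
  psum (fun k => RtoC (c k)) z
  = (RtoC (c 0%nat) + z * psum (fun k => RtoC (c (S k))) z)%C.
Proof.
intros Hc Hz; assert (Hs := psum_summable c z Hc Hz).
assert (Hd : disk_summable (fun k => c (S k))) by apply (disk_summable_decr_1 c Hc).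
unfold psum; rewrite <- Cseries_scal by (apply psum_summable; auto).
rewrite (Cseries_ext (fun k => z * _)%C (fun k => RtoC (c (S k)) * Cpow z (S k))%C)
  by (intros; rewrite Cpow_S; ring).
replace (RtoC (c 0%nat)) with (RtoC (c 0%nat) * Cpow z 0)%C by (simpl; ring).
apply injective_projections.
- apply (Series_incr_1 (fun k => Re (RtoC (c k) * Cpow z k)%C)), ex_series_Re, Hs.
- apply (Series_incr_1 (fun k => Im (RtoC (c k) * Cpow z k)%C)), ex_series_Im, Hs.
Qed.

Lemma psum_0 (z : C) : psum (fun _ => RtoC 0) z = RtoC 0.
Proof.
unfold psum; rewrite (Cseries_ext _ (fun _ => RtoC 0)) by (intros; ring).
unfold Cseries, RtoC; f_equal; simpl;
  rewrite (Series_ext _ (fun _ => 0 * 0)) by (intros; ring); rewrite Series_scal_l; ring.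
Qed.

(** Taylor coefficients of the identity function: [h] becomes [delta1] minus a nonnegative
    sequence. *)
Definition delta1 (k : nat) : R := if (k =? 1)%nat then 1 else 0.

Lemma disk_summable_delta1 : disk_summable delta1.
Proof.
apply disk_summable_le with (fun _ => 1).
- intros k; unfold delta1; destruct (k =? 1)%nat; rewrite ?Rabs_R0, Rabs_R1; lra.
- intros r Hr; apply (ex_series_ext (V := R_NormedModule) (fun k => Rabs r ^ k)).
  + intros k; rewrite Rmult_1_l, RPow_abs; auto.
  + apply ex_series_geom; rewrite Rabs_Rabsolu; auto.
Qed.

Lemma psum_derive_delta1 (z : C) : inU z ->
  psum (fun k => RtoC (PS_derive delta1 k)) z = RtoC 1.
Proof.
intros Hz; rewrite psum_incr_1; auto.
2: apply disk_summable_derive, disk_summable_delta1.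
rewrite (psum_ext _ (fun _ => RtoC 0)).
2: intros k; unfold PS_derive, delta1; simpl Nat.eqb; cbv iota; rewrite Rmult_0_r; auto.
rewrite psum_0; unfold PS_derive, delta1; simpl; rewrite Rmult_1_r; ring.
Qed.

Lemma psum_delta1 (z : C) : inU z -> psum (fun k => RtoC (delta1 k)) z = z.
Proof.
intros Hz; rewrite psum_incr_1 by (auto; apply disk_summable_delta1).
rewrite (psum_ext _ (fun k => RtoC (PS_derive delta1 k))).
- rewrite psum_derive_delta1; auto; unfold delta1; simpl; ring.
- intros [|k]; unfold PS_derive, delta1; simpl Nat.eqb; cbv iota.
  + simpl; rewrite Rmult_1_l; auto.
  + rewrite Rmult_0_r; auto.
Qed.

Lemma inU_RtoC (r : R) : 0 <= r < 1 -> inU (RtoC r).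
Proof. intros Hr; unfold inU; rewrite Cmod_R, Rabs_pos_eq; lra. Qed.

Lemma PSeries_delta1 (r : R) : 0 <= r < 1 -> PSeries delta1 r = r.
Proof.
intros Hr; apply RtoC_inj; rewrite <- psum_real; apply psum_delta1, inU_RtoC, Hr.
Qed.

Lemma Cmod_psum_nonneg_le (c : nat -> R) (z : C) :
  (forall k, 0 <= c k) -> disk_summable c -> inU z ->
  Cmod (psum (fun k => RtoC (c k)) z) <= PSeries c (Cmod z).
Proof.
intros c0 Hc Hz; apply Rle_trans with (1 := Cmod_psum_le c z Hc Hz).
apply Req_le, PSeries_ext; intros; apply Rabs_pos_eq, c0.
Qed.

(** * The quotient condition *)

(* [|N - D| < |N + (1 - 2 eta) D|] says that [N / D] is closer to [1] than to
   the mirror image [2 eta - 1] of [1] in the line [Re = eta]. *)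
Lemma Re_div_gt (N D : C) (eta : R) : eta < 1 ->
  Cmod (N - D) < Cmod (N + RtoC (1 - 2 * eta) * D) -> eta < Re (N / D)%C.
Proof.
intros eta1 H.
assert (H2 : Cmod (N - D) ^ 2 < Cmod (N + RtoC (1 - 2 * eta) * D) ^ 2).
{ generalize (Cmod_ge_0 (N - D)); nra. }
rewrite !Cmod2_alt in H2.
destruct N as [n1 n2], D as [d1 d2].
unfold Cdiv, Cinv, RtoC, Cminus, Cplus, Copp, Cmult, Re, Im in *; simpl in *.
assert (Q : eta * (d1 * d1 + d2 * d2) < n1 * d1 + n2 * d2) by nra.
assert (P : 0 < d1 * d1 + d2 * d2).
{ assert (0 <= d1 * d1) by nra; assert (0 <= d2 * d2) by nra.
  destruct (Req_dec d1 0) as [->|]; [destruct (Req_dec d2 0) as [->|]|]; nra. }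
apply Rmult_lt_reg_r with (d1 * d1 + d2 * d2); auto.
replace ((n1 * (d1 / (d1 * (d1 * 1) + d2 * (d2 * 1))) -
  n2 * (- d2 / (d1 * (d1 * 1) + d2 * (d2 * 1)))) * (d1 * d1 + d2 * d2))
  with (n1 * d1 + n2 * d2) by (field; lra).
auto.
Qed.

(** With [N] and [D] the numerator and denominator, [N - D] and
    [2 (1 - eta) z - (N + (1 - 2 eta) D)] are, up to sign and conjugation, sums of series with
    coefficients [mA - nA], [mB - sg nB], [mA + (1 - 2 eta) nA] and [mB + (1 - 2 eta) sg nB]. All
    are nonnegative, as [|sg|] and [|1 - 2 eta|] are at most [1]. The four bounds at [|z|] add up to
    twice the left side of the last hypothesis. *)
Lemma Re_quotient_gt (mA nA mB nB : nat -> R) (eta sg : R) (z : C) :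
  (forall k, 0 <= nA k <= mA k) -> (forall k, 0 <= nB k <= mB k) ->
  disk_summable mA -> disk_summable mB -> Rabs sg <= 1 -> 0 <= eta < 1 -> inU z ->
  PSeries mA (Cmod z) - eta * PSeries nA (Cmod z)
    + (PSeries mB (Cmod z) - eta * sg * PSeries nB (Cmod z)) < (1 - eta) * Cmod z ->
  eta < Re ((z - psum (fun k => RtoC (mA k)) z - Cconj (psum (fun k => RtoC (mB k)) z))
     / (z - psum (fun k => RtoC (nA k)) z
          - RtoC sg * Cconj (psum (fun k => RtoC (nB k)) z)))%C.
Proof.
intros HA HB SmA SmB Hsg Heta Hz Hr.
assert (SnA : disk_summable nA).
{ apply disk_summable_le with (2 := SmA); intros k; specialize (HA k).
  rewrite !Rabs_pos_eq; lra. }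
assert (SnB : disk_summable nB).
{ apply disk_summable_le with (2 := SmB); intros k; specialize (HB k).
  rewrite !Rabs_pos_eq; lra. }
assert (Hr1 : 0 <= Cmod z < 1) by (split; [apply Cmod_ge_0|auto]).
apply Rabs_le_between in Hsg.
apply Re_div_gt; [lra|].
assert (U1 := Cmod_psum_nonneg_le (fun k => mA k - nA k) z
  ltac:(intros k; specialize (HA k); lra) ltac:(auto using disk_summable_minus) Hz).
assert (U2 := Cmod_psum_nonneg_le (fun k => mB k - sg * nB k) z
  ltac:(intros k; specialize (HB k); simpl; nra)
  ltac:(auto using disk_summable_minus, disk_summable_scal) Hz).
assert (U3 := Cmod_psum_nonneg_le (fun k => mA k + (1 - 2 * eta) * nA k) z
  ltac:(intros k; specialize (HA k); simpl; nra)
  ltac:(auto using disk_summable_plus, disk_summable_scal) Hz).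
assert (U4 := Cmod_psum_nonneg_le (fun k => mB k + (1 - 2 * eta) * (sg * nB k)) z
  ltac:(intros k; specialize (HB k); simpl;
        assert (-1 <= (1 - 2 * eta) * sg) by nra; nra)
  ltac:(auto using disk_summable_plus, disk_summable_scal) Hz).
rewrite PSeries_minus_disk in U1, U2 by auto using disk_summable_scal.
rewrite PSeries_plus_disk in U3, U4 by auto using disk_summable_scal.
rewrite !PSeries_scal_fun in *.
rewrite psum_minus in U1, U2 by auto using disk_summable_scal.
rewrite psum_plus in U3, U4 by auto using disk_summable_scal.
rewrite (psum_scal (1 - 2 * eta) (fun k => sg * nB k)) in U4
  by auto using disk_summable_scal.
rewrite psum_scal in U2, U3, U4 by auto.
set (A := psum (fun k => RtoC (mA k)) z) in *.
set (B := psum (fun k => RtoC (mB k)) z) in *.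
set (A' := psum (fun k => RtoC (nA k)) z) in *.
set (B' := psum (fun k => RtoC (nB k)) z) in *.
set (e := RtoC (1 - 2 * eta)) in *.
rewrite <- (Cmod_conj (B - _)) in U2; rewrite <- (Cmod_conj (B + _)) in U4.
assert (Cr : forall x, Cconj (RtoC x) = RtoC x).
{ intros; unfold Cconj, RtoC; simpl; f_equal; ring. }
replace (Cconj (B - sg * B')) with (Cconj B - sg * Cconj B')%C in U2
  by (rewrite <- (Cr sg), <- Cmult_conj, <- Cminus_conj, Cr; auto).
replace (Cconj (B + e * (sg * B'))) with (Cconj B + e * (sg * Cconj B'))%C in U4
  by (unfold e; rewrite <- (Cr sg), <- (Cr (1 - 2 * eta)), <- !Cmult_conj, <- Cplus_conj,
      !Cr; auto).
set (X := Cconj B) in *; set (X' := Cconj B') in *.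
assert (L : Cmod (z - A - X - (z - A' - sg * X')) <=
  Cmod (A - A') + Cmod (X - sg * X')).
{ replace (z - A - X - (z - A' - sg * X'))%C with (- ((A - A') + (X - sg * X')))%C by ring.
  rewrite Cmod_opp; apply Cmod_triangle. }
assert (G : 2 * (1 - eta) * Cmod z <= Cmod (z - A - X + e * (z - A' - sg * X'))
   + (Cmod (A + e * A') + Cmod (X + e * (sg * X')))).
{ replace (2 * (1 - eta) * Cmod z) with (Cmod (RtoC (2 * (1 - eta)) * z))
    by (rewrite Cmod_mult, Cmod_R, Rabs_pos_eq; lra).
  replace (RtoC (2 * (1 - eta)) * z)%C with
    ((z - A - X + e * (z - A' - sg * X')) + ((A + e * A') + (X + e * (sg * X'))))%C.
  - apply Rle_trans with (1 := Cmod_triangle _ _), Rplus_le_compat_l, Cmod_triangle.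
  - replace (2 * (1 - eta)) with (1 + (1 - 2 * eta)) by ring.
    rewrite RtoC_plus; unfold e; ring. }
lra.
Qed.

(** At [y = 0] both sides are [0] by the convention on inverses, so the identity covers a vanishing
    denominator as well. *)
Lemma Re_div_real (x y : R) : Re (RtoC x / RtoC y)%C = x / y.
Proof.
unfold Cdiv, Cinv, RtoC, Cmult, Re; simpl.
destruct (Req_dec y 0) as [->|y0]; [unfold Rdiv; rewrite Rinv_0; ring|field; nra].
Qed.

Lemma PSeries_pos_of_nonvanishing_1 (c : nat -> R) :
  disk_summable c -> c 0%nat = 0 -> 0 < c 1%nat ->
  (forall r, 0 < r < 1 -> PSeries c r <> 0) ->
  forall r, 0 < r < 1 -> 0 < PSeries c r.
Proof.
intros Hc c0 c1 nz r Hr; rewrite PSeries_decr_1_aux by auto.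
apply Rmult_lt_0_compat; [lra|].
apply PSeries_pos_of_nonvanishing; auto; [| |lra].
- apply disk_summable_decr_1, Hc.
- intros x Hx E; apply (nz x Hx); rewrite PSeries_decr_1_aux, E by auto; ring.
Qed.

(* A vanishing denominator gives the quotient [0], so it is excluded by [0 <= eta];
   the denominator then keeps the sign it has near [0]. *)
Lemma quotient_gt_coeff_lt (mA nA mB nB : nat -> R) (eta sg : R) :
  disk_summable mA -> disk_summable nA -> disk_summable mB -> disk_summable nB ->
  nA 0%nat = 0 -> nA 1%nat = 0 ->
  nB 0%nat = 0 -> sg * nB 1%nat < 1 -> 0 <= eta ->
  (forall r, 0 < r < 1 -> eta <
     (r - PSeries mA r - PSeries mB r) / (r - PSeries nA r - sg * PSeries nB r)) ->
  forall r, 0 < r < 1 ->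
  PSeries mA r - eta * PSeries nA r
    + (PSeries mB r - eta * sg * PSeries nB r) < (1 - eta) * r.
Proof.
intros SmA SnA SmB SnB nA0 nA1 nB0 nB1 Heta H.
assert (Sd := disk_summable_delta1).
(* Coefficients of the denominator; the one at index [1] is [1 - sg * nB 1], which is positive. *)
set (D := fun k => delta1 k - nA k - sg * nB k).
assert (ED : forall r, 0 < r < 1 -> PSeries D r = r - PSeries nA r - sg * PSeries nB r).
{ intros r Hr; unfold D; rewrite !PSeries_minus_disk, PSeries_delta1, PSeries_scal_fun;
    auto using disk_summable_minus, disk_summable_scal; lra. }
assert (PD : forall r, 0 < r < 1 -> 0 < PSeries D r).
{ apply PSeries_pos_of_nonvanishing_1; unfold D, delta1; simpl.
  - apply disk_summable_minus; auto using disk_summable_minus, disk_summable_scal.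
  - rewrite nA0, nB0; ring.
  - rewrite nA1; lra.
  - intros r Hr E; fold delta1 in E; specialize (H r Hr).
    change (PSeries D r = 0) in E.
    rewrite ED in E by auto; rewrite E in H; unfold Rdiv in H; rewrite Rinv_0 in H; lra. }
intros r Hr; specialize (H r Hr); specialize (PD r Hr); rewrite ED in PD by auto.
apply (Rmult_lt_compat_r _ _ _ PD) in H.
unfold Rdiv in H; rewrite Rmult_assoc, Rinv_l in H; lra.
Qed.

(** * Harmonic mappings with signed coefficients *)

(** The class leaves [a 0], [a 1] and [b 0] free; replacing them by zero gives sequences that are
    nonnegative at every index. *)
Definition tail_from (i : nat) (c : nat -> R) (k : nat) : R :=
  if (i <=? k)%nat then c k else 0.

Lemma tail_from_nonneg (i : nat) (c : nat -> R) :
  (forall k, (i <= k)%nat -> 0 <= c k) -> forall k, 0 <= tail_from i c k.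
Proof.
intros H k; unfold tail_from; destruct (Nat.leb_spec i k); [apply H; auto|lra].
Qed.

Lemma hseq_opp (a : nat -> R) (k : nat) :
  hseq (fun k => RtoC (- a k)) k = RtoC (delta1 k - tail_from 2 a k).
Proof.
unfold hseq, delta1, tail_from; destruct k as [|[|k]]; simpl; f_equal; ring.
Qed.

Lemma gseq_sign (x : R) (b : nat -> R) (k : nat) :
  gseq (fun k => RtoC (x * b k)) k = RtoC (x * tail_from 1 b k).
Proof.
unfold gseq, tail_from; destruct k; simpl; f_equal; ring.
Qed.

Lemma PhiSeq_hseq_opp (al be ga de p q : R) (m : nat) (a : nat -> R) (k : nat) :
  PhiSeq al be ga de p q m (hseq (fun k => RtoC (- a k))) k =
  RtoC (delta1 k - Ck al be ga de p q m k * tail_from 2 a k).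
Proof.
unfold PhiSeq; rewrite hseq_opp, <- RtoC_mult; f_equal.
unfold delta1, tail_from; destruct k as [|[|k]]; unfold Ck; simpl; ring.
Qed.

Lemma PhiSeq_gseq_sign (al be ga de p q : R) (m : nat) (x : R) (b : nat -> R) (k : nat) :
  PhiSeq al be ga de p q m (gseq (fun k => RtoC (x * b k))) k =
  RtoC (x * (Ck al be ga de p q m k * tail_from 1 b k)).
Proof.
unfold PhiSeq; rewrite gseq_sign, <- RtoC_mult; f_equal; ring.
Qed.

Lemma Cconj_RtoC (x : R) : Cconj (RtoC x) = RtoC x.
Proof. unfold Cconj, RtoC; simpl; f_equal; ring. Qed.

(** The sign has the shape expected by [Re_quotient_gt]: for [x = (-1)^(m-1)] it is [1] in
    [Phi^m f], and the same expression with [n] in place of the exponent [m] is [sg]. *)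
Lemma Phi_eq (al be ga de p q : R) (m : nat) (x : R) (a b : nat -> R) (z : C) :
  disk_summable (fun k => Ck al be ga de p q m k * tail_from 2 a k) ->
  disk_summable (fun k => Ck al be ga de p q m k * tail_from 1 b k) -> inU z ->
  Phi al be ga de p q m (fun k => RtoC (- a k)) (fun k => RtoC (x * b k)) z =
  (z - psum (fun k => RtoC (Ck al be ga de p q m k * tail_from 2 a k)) z
     - RtoC (- ((-1) ^ m * x))
       * Cconj (psum (fun k => RtoC (Ck al be ga de p q m k * tail_from 1 b k)) z))%C.
Proof.
intros Ha Hb Hz; unfold Phi.
rewrite (psum_ext _ _ z (PhiSeq_hseq_opp al be ga de p q m a)).
rewrite (psum_ext _ _ z (PhiSeq_gseq_sign al be ga de p q m x b)).
rewrite psum_minus, psum_delta1, psum_scal by auto using disk_summable_delta1.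
rewrite Cmult_conj, Cconj_RtoC, RtoC_opp, RtoC_mult; ring.
Qed.

Lemma harm_eq (x : R) (a b : nat -> R) (z : C) :
  disk_summable (tail_from 2 a) -> disk_summable (tail_from 1 b) -> inU z ->
  harm (fun k => RtoC (- a k)) (fun k => RtoC (x * b k)) z =
  (z - psum (fun k => RtoC (tail_from 2 a k)) z
     + RtoC x * Cconj (psum (fun k => RtoC (tail_from 1 b k)) z))%C.
Proof.
intros Ha Hb Hz; unfold harm.
rewrite (psum_ext _ _ z (hseq_opp a)), (psum_ext _ _ z (gseq_sign x b)).
rewrite psum_minus, psum_delta1, psum_scal by auto using disk_summable_delta1.
rewrite Cmult_conj, Cconj_RtoC; auto.
Qed.

Lemma PSeries_derive_nonneg_Rabs (c : nat -> R) (r : R) : (forall k, 0 <= c k) ->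
  PSeries (PS_derive (fun k => Rabs (c k))) r = PSeries (PS_derive c) r.
Proof.
intros c0; apply PSeries_ext; intros k; unfold PS_derive; rewrite Rabs_pos_eq; auto.
Qed.

Lemma psum_derive_hseq_opp (a : nat -> R) (z : C) :
  disk_summable (tail_from 2 a) -> inU z ->
  is_derive (K := C_AbsRing) (V := C_NormedModule)
    (psum (hseq (fun k => RtoC (- a k)))) z
    (RtoC 1 - psum (fun k => RtoC (PS_derive (tail_from 2 a) k)) z)%C.
Proof.
intros Ha Hz.
apply (is_derive_ext (psum (fun k => RtoC (delta1 k - tail_from 2 a k)))).
{ intros w; apply psum_ext; intros; symmetry; apply hseq_opp. }
rewrite <- (psum_derive_delta1 z Hz), <- psum_minus;
  auto using disk_summable_derive, disk_summable_delta1.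
rewrite (psum_ext _ (fun k => RtoC (PS_derive (fun k => delta1 k - tail_from 2 a k) k)))
  by (intros; f_equal; unfold PS_derive; ring).
apply is_derive_psum; auto using disk_summable_minus, disk_summable_delta1.
Qed.

Lemma psum_derive_gseq_sign (x : R) (b : nat -> R) (z : C) :
  disk_summable (tail_from 1 b) -> inU z ->
  is_derive (K := C_AbsRing) (V := C_NormedModule)
    (psum (gseq (fun k => RtoC (x * b k)))) z
    (RtoC x * psum (fun k => RtoC (PS_derive (tail_from 1 b) k)) z)%C.
Proof.
intros Hb Hz.
apply (is_derive_ext (psum (fun k => RtoC (x * tail_from 1 b k)))).
{ intros w; apply psum_ext; intros; symmetry; apply gseq_sign. }
rewrite <- psum_scal; auto using disk_summable_derive.
rewrite (psum_ext _ (fun k => RtoC (PS_derive (fun k => x * tail_from 1 b k) k)))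
  by (intros; f_equal; unfold PS_derive; ring).
apply is_derive_psum; auto using disk_summable_scal.
Qed.

(** If the values agree, [w - z] equals the increment of the remaining terms, whose modulus is at
    most a factor below [1] times [|w - z|]; hence [w = z]. *)
Lemma harm_injective (x : R) (a b : nat -> R) :
  (forall k, 0 <= tail_from 2 a k) -> (forall k, 0 <= tail_from 1 b k) -> Rabs x = 1 ->
  disk_summable (tail_from 2 a) -> disk_summable (tail_from 1 b) ->
  (forall r, 0 <= r < 1 ->
     PSeries (PS_derive (tail_from 2 a)) r + PSeries (PS_derive (tail_from 1 b)) r < 1) ->
  forall z w, inU z -> inU w ->
  harm (fun k => RtoC (- a k)) (fun k => RtoC (x * b k)) z =
  harm (fun k => RtoC (- a k)) (fun k => RtoC (x * b k)) w -> z = w.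
Proof.
intros a0 b0 Hx Ha Hb H z w Hz Hw E.
rewrite !harm_eq in E by auto; unfold inU in *.
set (r := Rmax (Cmod z) (Cmod w)).
assert (Hr : 0 <= r < 1).
{ split; [apply Rle_trans with (2 := Rmax_l _ _), Cmod_ge_0|apply Rmax_lub_lt; auto]. }
assert (LA := psum_lipschitz _ z w r Ha (Rmax_l _ _) (Rmax_r _ _) (proj2 Hr)).
assert (LB := psum_lipschitz _ z w r Hb (Rmax_l _ _) (Rmax_r _ _) (proj2 Hr)).
rewrite PSeries_derive_nonneg_Rabs in LA, LB by auto.
specialize (H r Hr).
rewrite <- (Cmod_conj (_ - _)), Cminus_conj in LB.
set (A := psum (fun k => RtoC (tail_from 2 a k))) in *.
set (B := psum (fun k => RtoC (tail_from 1 b k))) in *.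
assert (D : (w - z = (A w - A z) - RtoC x * (Cconj (B w) - Cconj (B z)))%C).
{ replace (w - z)%C with ((w - A w + x * Cconj (B w)) - (z - A z + x * Cconj (B z))
    + ((A w - A z) - RtoC x * (Cconj (B w) - Cconj (B z))))%C by ring.
  rewrite E; ring. }
assert (L : Cmod (w - z) <= Cmod (A w - A z) + Cmod (Cconj (B w) - Cconj (B z))).
{ rewrite D at 1; apply Rle_trans with (1 := Cmod_triangle _ _).
  rewrite Cmod_opp, Cmod_mult, Cmod_R, Hx; lra. }
assert (Z : Cmod (w - z) = 0) by (generalize (Cmod_ge_0 (w - z)); nra).
apply Cmod_eq_0 in Z; replace w with (z + (w - z))%C by ring; rewrite Z; ring.
Qed.

(** With [A], [B] the two real series, [|g'| <= B'(|z|) < 1 - A'(|z|) <= |h'|]. *)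
Lemma harm_sense_preserving (x : R) (a b : nat -> R) (z : C) :
  (forall k, 0 <= tail_from 2 a k) -> (forall k, 0 <= tail_from 1 b k) -> Rabs x = 1 ->
  disk_summable (tail_from 2 a) -> disk_summable (tail_from 1 b) ->
  PSeries (PS_derive (tail_from 2 a)) (Cmod z)
    + PSeries (PS_derive (tail_from 1 b)) (Cmod z) < 1 -> inU z ->
  Cmod (RtoC x * psum (fun k => RtoC (PS_derive (tail_from 1 b) k)) z) <
  Cmod (RtoC 1 - psum (fun k => RtoC (PS_derive (tail_from 2 a) k)) z).
Proof.
intros a0 b0 Hx Ha Hb H Hz.
rewrite Cmod_mult, Cmod_R, Hx, Rmult_1_l.
assert (d0 : forall c, (forall k, 0 <= c k) -> forall k, 0 <= PS_derive c k).
{ intros; apply Rmult_le_pos; auto using pos_INR. }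
assert (A := Cmod_psum_nonneg_le _ z (d0 _ a0) (disk_summable_derive _ Ha) Hz).
assert (B := Cmod_psum_nonneg_le _ z (d0 _ b0) (disk_summable_derive _ Hb) Hz).
set (P := psum (fun k => RtoC (PS_derive (tail_from 2 a) k)) z) in *.
assert (T := Cmod_triangle (1 - P) P).
replace (1 - P + P)%C with (RtoC 1) in T by ring; rewrite Cmod_1 in T; lra.
Qed.

Lemma sense_preserving_coeff_lt (x : R) (a b : nat -> R) :
  (forall k, 0 <= tail_from 2 a k) -> (forall k, 0 <= tail_from 1 b k) -> Rabs x = 1 ->
  disk_summable (tail_from 2 a) -> disk_summable (tail_from 1 b) ->
  (forall z, inU z -> exists dh dg : C,
     is_derive (psum (hseq (fun k => RtoC (- a k)))) z dh /\
     is_derive (psum (gseq (fun k => RtoC (x * b k)))) z dg /\ Cmod dg < Cmod dh) ->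
  forall r, 0 <= r < 1 ->
  PSeries (PS_derive (tail_from 2 a)) r + PSeries (PS_derive (tail_from 1 b)) r < 1.
Proof.
intros a0 b0 Hx Ha Hb H.
assert (K : forall r, 0 <= r < 1 -> Rabs (PSeries (PS_derive (tail_from 1 b)) r)
  < Rabs (1 - PSeries (PS_derive (tail_from 2 a)) r)).
{ intros r Hr; destruct (H (RtoC r) (inU_RtoC r Hr)) as (dh & dg & Dh & Dg & L).
  apply is_C_derive_unique in Dh; apply is_C_derive_unique in Dg.
  rewrite <- Dh, <- Dg in L.
  rewrite (is_C_derive_unique _ _ _ (psum_derive_hseq_opp a (RtoC r) Ha (inU_RtoC r Hr))),
    (is_C_derive_unique _ _ _ (psum_derive_gseq_sign x b (RtoC r) Hb (inU_RtoC r Hr))) in L.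
  rewrite !psum_real, <- RtoC_minus, <- RtoC_mult, !Cmod_R, Rabs_mult, Hx, Rmult_1_l in L.
  auto. }
set (c := fun k => PS_derive delta1 k - PS_derive (tail_from 2 a) k).
assert (Sd := disk_summable_derive _ disk_summable_delta1).
assert (Sa := disk_summable_derive _ Ha).
assert (Ec : forall r, 0 <= r < 1 ->
  PSeries c r = 1 - PSeries (PS_derive (tail_from 2 a)) r).
{ intros r Hr; unfold c; rewrite PSeries_minus_disk by auto; f_equal.
  apply RtoC_inj; rewrite <- psum_real; apply psum_derive_delta1, inU_RtoC, Hr. }
intros r Hr; specialize (K r Hr) as Kr; rewrite <- Ec in Kr by auto.
rewrite (Rabs_pos_eq (PSeries c r)) in Kr.
- rewrite Ec in Kr by auto; generalize (Rle_abs (PSeries (PS_derive (tail_from 1 b)) r)).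
  lra.
- apply Rlt_le, PSeries_pos_of_nonvanishing; auto.
  + apply disk_summable_minus; auto.
  + unfold c, PS_derive, delta1, tail_from; simpl; lra.
  (* A zero of [h'] would leave [|g'| < 0]. *)
  + intros s Hs E; assert (Ks := K s ltac:(lra)); rewrite <- Ec, E, Rabs_R0 in Ks by lra.
    generalize (Rabs_pos (PSeries (PS_derive (tail_from 1 b)) s)); lra.
Qed.

(** * Coefficient bounds and the description of the class by inequalities *)

Lemma PSeries_ge_term (c : nat -> R) (r : R) (j : nat) :
  (forall k, 0 <= c k) -> disk_summable c -> 0 <= r < 1 -> c j * r ^ j <= PSeries c r.
Proof.
intros c0 Hc Hr; revert c c0 Hc; induction j as [|j IH]; intros c c0 Hc;
  (rewrite PSeries_decr_1;
   [|apply CV_radius_inside, Rbar_lt_le_trans with 1;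
     [rewrite Rabs_pos_eq; simpl; lra|apply disk_summable_radius, Hc]]).
all: assert (Sc := disk_summable_decr_1 c Hc).
- assert (P := PSeries_nonneg (PS_decr_1 c) r (fun k => c0 (S k)) Sc Hr).
  simpl; nra.
- specialize (IH (PS_decr_1 c) (fun k => c0 (S k)) Sc).
  apply (Rmult_le_compat_l r) in IH; [|lra].
  specialize (c0 0%nat); unfold PS_decr_1 in *; simpl; lra.
Qed.

(** Bernoulli's inequality. *)
Lemma one_minus_pow_ge (t : R) (j : nat) : 0 <= t <= 1 -> 1 - INR j * t <= (1 - t) ^ j.
Proof.
intros Ht; induction j as [|j IH]; [simpl; lra|].
rewrite S_INR; simpl; assert (J := pos_INR j).
apply (Rmult_le_compat_l (1 - t)) in IH; [|lra].
assert (0 <= INR j * t * t) by (repeat apply Rmult_le_pos; lra).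
lra.
Qed.

(** One radius per index replaces the limit [r -> 1]. It loses a factor [2], which the factor [k]
    from the derivative absorbs for [k >= 2]; at [k = 1] the power of [r] is [1] and nothing is
    lost. *)
Lemma coeff_le_1_of_derive (c : nat -> R) :
  (forall k, 0 <= c k) -> disk_summable c -> c 0%nat = 0 ->
  (forall r, 0 <= r < 1 -> PSeries (PS_derive c) r < 1) -> forall k, c k <= 1.
Proof.
intros c0 Hc cz H [|j]; [lra|].
assert (J := pos_INR j).
(* Chosen so that Bernoulli's inequality gives [(1 - t)^j >= 1/2]. *)
set (t := / (2 * INR (S j))).
assert (Et : 2 * INR (S j) * t = 1) by (unfold t; rewrite S_INR; field; lra).
rewrite S_INR in Et.
assert (Ht : 0 < t <= 1 / 2).
{ split; [unfold t; rewrite S_INR; apply Rinv_0_lt_compat; lra|].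
  assert (0 < t) by (unfold t; rewrite S_INR; apply Rinv_0_lt_compat; lra); nra. }
assert (d0 : forall k, 0 <= PS_derive c k).
{ intros; apply Rmult_le_pos; auto using pos_INR. }
assert (T := PSeries_ge_term _ (1 - t) j d0 (disk_summable_derive _ Hc) ltac:(lra)).
specialize (H (1 - t) ltac:(lra)).
assert (B := one_minus_pow_ge t j ltac:(lra)).
assert (L : PS_derive c j * (1 - t) ^ j < 1) by lra.
destruct j as [|j].
- unfold PS_derive in L; simpl in *; lra.
- unfold PS_derive in L; rewrite S_INR in L.
  assert (J1 := pos_INR j); rewrite (S_INR j) in *.
  specialize (c0 (S (S j))).
  assert (P : 1 / 2 <= (1 - t) ^ S j) by lra.
  assert (Q : (INR j + 1 + 1) * c (S (S j)) * (1 / 2)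
     <= (INR j + 1 + 1) * c (S (S j)) * (1 - t) ^ S j).
  { apply Rmult_le_compat_l; [apply Rmult_le_pos; lra|auto]. }
  nra.
Qed.

(* [- sg] is the sign of the antianalytic part of [Phi^n f]; for [Phi^m f] it is [-1]. *)
Lemma SHbar_coeff (al be ga de p q : R) (m n : nat) (eta : R) (a b : nat -> R) :
  let cM := Ck al be ga de p q m in
  let cN := Ck al be ga de p q n in
  let a' := tail_from 2 a in
  let b' := tail_from 1 b in
  let sg := - ((-1) ^ n * (-1) ^ (m - 1)) in
  (n < m)%nat -> 0 <= eta -> SHbar al be ga de p q m n eta a b ->
  ((forall k, 0 <= a' k) /\ (forall k, 0 <= b' k) /\
   disk_summable a' /\ disk_summable b' /\
   disk_summable (fun k => cM k * a' k) /\ disk_summable (fun k => cM k * b' k) /\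
   disk_summable (fun k => cN k * a' k) /\ disk_summable (fun k => cN k * b' k)) /\
  (forall r, 0 <= r < 1 -> PSeries (PS_derive a') r + PSeries (PS_derive b') r < 1) /\
  (forall r, 0 < r < 1 ->
     PSeries (fun k => cM k * a' k) r - eta * PSeries (fun k => cN k * a' k) r
     + (PSeries (fun k => cM k * b' k) r - eta * sg * PSeries (fun k => cN k * b' k) r)
     < (1 - eta) * r).
Proof.
intros cM cN a' b' sg nm eta0 (a0 & b0 & Sf & SPhi & _ & sense & b1 & quot).
set (x := (-1) ^ (m - 1)) in *.
assert (Hx : Rabs x = 1) by apply pow_1_abs.
assert (a'0 : forall k, 0 <= a' k) by (apply tail_from_nonneg, a0).
assert (b'0 : forall k, 0 <= b' k) by (apply tail_from_nonneg, b0).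
assert (SA : forall s c, (forall k, s k = RtoC (delta1 k - c k)) ->
  (forall z, inU z -> ex_series (fun k => s k * Cpow z k)%C) -> disk_summable c).
{ intros s c E H; apply disk_summable_le with (fun k => delta1 k - (delta1 k - c k)).
  - intros k; apply Req_le; f_equal; ring.
  - apply disk_summable_minus; [apply disk_summable_delta1|].
    apply disk_summable_of_psum; intros z Hz.
    eapply ex_series_ext; [|apply H, Hz]; intros; rewrite <- E; auto. }
assert (SB : forall s c, (forall k, s k = RtoC (x * c k)) ->
  (forall z, inU z -> ex_series (fun k => s k * Cpow z k)%C) -> disk_summable c).
{ intros s c E H; apply disk_summable_le with (fun k => x * c k).
  - intros k; rewrite Rabs_mult, Hx; lra.
  - apply disk_summable_of_psum; intros z Hz.
    eapply ex_series_ext; [|apply H, Hz]; intros; rewrite <- E; auto. }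
assert (Sa : disk_summable a') by (apply (SA _ _ (hseq_opp a)); apply Sf).
assert (Sb : disk_summable b') by (apply (SB _ _ (gseq_sign x b)); apply Sf).
assert (SMa : disk_summable (fun k => cM k * a' k))
  by (apply (SA _ _ (PhiSeq_hseq_opp al be ga de p q m a)); apply SPhi).
assert (SMb : disk_summable (fun k => cM k * b' k))
  by (apply (SB _ _ (PhiSeq_gseq_sign al be ga de p q m x b)); apply SPhi).
assert (SNa : disk_summable (fun k => cN k * a' k))
  by (apply (SA _ _ (PhiSeq_hseq_opp al be ga de p q n a)); apply SPhi).
assert (SNb : disk_summable (fun k => cN k * b' k))
  by (apply (SB _ _ (PhiSeq_gseq_sign al be ga de p q n x b)); apply SPhi).
split; [repeat split; auto|].
split; [apply (sense_preserving_coeff_lt x); auto|].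
apply quotient_gt_coeff_lt; auto.
- unfold a', tail_from; simpl; ring.
- unfold a', tail_from; simpl; ring.
- unfold b', tail_from; simpl; ring.
(* As [Ck] is [1] at index [1], this is the condition [|b_1| < 1]. *)
- rewrite Cmod_R, Rabs_mult, Hx, Rmult_1_l in b1.
  assert (Hs : Rabs sg = 1) by (unfold sg; rewrite Rabs_Ropp, Rabs_mult, Hx, pow_1_abs; lra).
  unfold b', tail_from, cN, Ck; simpl; rewrite Rmult_1_l.
  apply Rle_lt_trans with (1 := Rle_abs _).
  rewrite Rabs_mult, Hs; lra.
- intros r Hr.
  assert (r0 : RtoC r <> RtoC 0) by (intros E; apply RtoC_inj in E; lra).
  assert (rU := inU_RtoC r ltac:(lra)).
  specialize (quot (RtoC r) rU r0).
  rewrite !Phi_eq in quot by auto.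
  rewrite !psum_real, !Cconj_RtoC, <- !RtoC_mult, <- !RtoC_minus, Re_div_real in quot.
  fold cM cN a' b' sg in quot.
  (* The exponents [m] and [m - 1] have odd sum; [n < m] gives [m >= 1], so the subtraction is
     exact. *)
  replace (- ((-1) ^ m * x)) with 1 in quot; [rewrite Rmult_1_l in quot; auto|].
  unfold x; rewrite <- pow_add; replace (m + (m - 1))%nat with (S (2 * (m - 1))) by lia.
  rewrite pow_1_odd; ring.
Qed.

Lemma SHbar_of_coeff (al be ga de p q : R) (m n : nat) (eta : R) (a b : nat -> R) :
  let cM := Ck al be ga de p q m in
  let cN := Ck al be ga de p q n in
  let a' := tail_from 2 a in
  let b' := tail_from 1 b in
  let sg := - ((-1) ^ n * (-1) ^ (m - 1)) in
  (n < m)%nat -> 0 <= eta < 1 -> (forall k, 0 <= cN k <= cM k) ->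
  (forall k, (2 <= k)%nat -> 0 <= a k) -> (forall k, (1 <= k)%nat -> 0 <= b k) ->
  disk_summable a' -> disk_summable b' ->
  disk_summable (fun k => cM k * a' k) -> disk_summable (fun k => cM k * b' k) ->
  (forall r, 0 <= r < 1 -> PSeries (PS_derive a') r + PSeries (PS_derive b') r < 1) ->
  (forall r, 0 < r < 1 ->
     PSeries (fun k => cM k * a' k) r - eta * PSeries (fun k => cN k * a' k) r
     + (PSeries (fun k => cM k * b' k) r - eta * sg * PSeries (fun k => cN k * b' k) r)
     < (1 - eta) * r) ->
  SHbar al be ga de p q m n eta a b.
Proof.
intros cM cN a' b' sg nm Heta HC a0 b0 Sa Sb SMa SMb Hder Hq.
assert (a'0 : forall k, 0 <= a' k) by (apply tail_from_nonneg, a0).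
assert (b'0 : forall k, 0 <= b' k) by (apply tail_from_nonneg, b0).
assert (NM : forall c, (forall k, 0 <= c k) -> forall k, 0 <= cN k * c k <= cM k * c k).
{ intros c c0 k; specialize (c0 k); destruct (HC k); split;
    [apply Rmult_le_pos|apply Rmult_le_compat_r]; auto. }
assert (SN : forall c, (forall k, 0 <= c k) -> disk_summable (fun k => cM k * c k) ->
  disk_summable (fun k => cN k * c k)).
{ intros c c0; apply disk_summable_le; intros k; destruct (NM c c0 k).
  rewrite !Rabs_pos_eq; lra. }
split; [exact a0|split; [exact b0|]].
set (x := (-1) ^ (m - 1)) in *.
assert (Hx : Rabs x = 1) by apply pow_1_abs.
assert (SA : forall s c z, (forall k, s k = RtoC (delta1 k - c k)) -> disk_summable c ->
  inU z -> ex_series (fun k => s k * Cpow z k)%C).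
{ intros s c z E H Hz; apply ex_series_ext with (fun k => RtoC (delta1 k - c k) * Cpow z k)%C.
  - intros; rewrite E; auto.
  - apply (psum_ex_series (fun k => delta1 k - c k)); auto.
    auto using disk_summable_minus, disk_summable_delta1. }
assert (SB : forall s c z, (forall k, s k = RtoC (x * c k)) -> disk_summable c ->
  inU z -> ex_series (fun k => s k * Cpow z k)%C).
{ intros s c z E H Hz; apply ex_series_ext with (fun k => RtoC (x * c k) * Cpow z k)%C.
  - intros; rewrite E; auto.
  - apply (psum_ex_series (fun k => x * c k)); auto using disk_summable_scal. }
unfold SH; repeat match goal with |- _ /\ _ => split end.
- intros z Hz; split; [apply (SA _ _ z (hseq_opp a))|apply (SB _ _ z (gseq_sign x b))]; auto.
- intros z Hz; repeat split.
  + apply (SA _ _ z (PhiSeq_hseq_opp al be ga de p q m a)); auto.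
  + apply (SB _ _ z (PhiSeq_gseq_sign al be ga de p q m x b)); auto.
  + apply (SA _ _ z (PhiSeq_hseq_opp al be ga de p q n a)); auto; apply SN; auto.
  + apply (SB _ _ z (PhiSeq_gseq_sign al be ga de p q n x b)); auto; apply SN; auto.
- apply (harm_injective x); auto.
- intros z Hz.
  exists (RtoC 1 - psum (fun k => RtoC (PS_derive a' k)) z)%C,
    (RtoC x * psum (fun k => RtoC (PS_derive b' k)) z)%C.
  split; [apply psum_derive_hseq_opp; auto|].
  split; [apply psum_derive_gseq_sign; auto|].
  apply harm_sense_preserving; auto.
  apply Hder; split; auto using Cmod_ge_0.
(* At [r = 0] the inequality on the derivatives reads [b 1 < 1]. *)
- specialize (Hder 0 ltac:(lra)); rewrite !PSeries_0 in Hder.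
  rewrite Cmod_R, Rabs_mult, Hx, Rmult_1_l, Rabs_pos_eq by (apply b0; lia).
  unfold PS_derive, a', b', tail_from in Hder; simpl in Hder; lra.
- intros z Hz z0; rewrite !Phi_eq by auto; fold cM cN a' b' sg.
  replace (- ((-1) ^ m * x)) with 1.
  + rewrite Cmult_1_l; apply Re_quotient_gt; auto.
    * unfold sg; rewrite Rabs_Ropp, Rabs_mult, Hx, pow_1_abs; lra.
    * apply Hq; split; auto; apply Cmod_gt_0, z0.
  + unfold x; rewrite <- pow_add; replace (m + (m - 1))%nat with (S (2 * (m - 1))) by lia.
    rewrite pow_1_odd; ring.
Qed.

Lemma PS_derive_nonneg (c : nat -> R) :
  (forall k, 0 <= c k) -> forall k, 0 <= PS_derive c k.
Proof. intros c0 k; apply Rmult_le_pos; auto using pos_INR. Qed.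

Theorem theorem4p1 (al be ga de p q rho eta : R) (m n : nat) :
  0 < al -> 0 < be -> 0 < ga -> 0 < de -> 0 < p -> 0 < q -> q <= al + p ->
  0 <= rho -> rho <= eta -> eta < 1 -> (n < m)%nat ->
  (forall a b A B : nat -> R,
     SHbar al be ga de p q m n eta a b ->
     SHbar al be ga de p q m n rho A B ->
     SHbar al be ga de p q m n eta (fun k => Rabs (a k) * Rabs (A k))
                                   (fun k => Rabs (b k) * Rabs (B k))) /\
  (forall a b : nat -> R,
     SHbar al be ga de p q m n eta a b -> SHbar al be ga de p q m n rho a b).
Proof.
intros al0 be0 ga0 de0 p0 q0 _ rho0 rho_eta eta1 nm.
assert (HC : forall k, 0 <= Ck al be ga de p q n k <= Ck al be ga de p q m k).
{ intros k; split; [apply Rlt_le, Ck_pos; auto|apply Ck_le; auto; lia]. }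
split.
(* For the inclusion, only the quotient condition mentions the order, and [rho <= eta]. *)
2:{ intros a b (a0 & b0 & H1 & H2 & H3 & H4 & H5 & H6).
  refine (conj a0 (conj b0 (conj H1 (conj H2 (conj H3 (conj H4 (conj H5 _))))))).
  intros z Hz z0; apply Rle_lt_trans with (1 := rho_eta); exact (H6 z Hz z0). }
intros a b A B Hf HF.
destruct (SHbar_coeff _ _ _ _ _ _ _ _ _ _ _ nm rho0 HF)
  as ((A0 & B0 & SA & SB & _) & dF & _).
assert (a0 := proj1 Hf); assert (b0 := proj1 (proj2 Hf)).
destruct (SHbar_coeff _ _ _ _ _ _ _ _ _ _ _ nm (Rle_trans _ _ _ rho0 rho_eta) Hf)
  as ((a'0 & b'0 & Sa & Sb & SMa & SMb & SNa & SNb) & df & qf).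
clear Hf HF.
set (cM := Ck al be ga de p q m) in *; set (cN := Ck al be ga de p q n) in *.
assert (A1 : forall k, tail_from 2 A k <= 1).
{ apply coeff_le_1_of_derive; auto; intros r Hr; specialize (dF r Hr).
  assert (P := PSeries_nonneg _ r (PS_derive_nonneg _ B0) (disk_summable_derive _ SB) Hr).
  lra. }
assert (B1 : forall k, tail_from 1 B k <= 1).
{ apply coeff_le_1_of_derive; auto; intros r Hr; specialize (dF r Hr).
  assert (P := PSeries_nonneg _ r (PS_derive_nonneg _ A0) (disk_summable_derive _ SA) Hr).
  lra. }
assert (T : forall i c d, (forall k, 0 <= tail_from i c k) ->
  (forall k, 0 <= tail_from i d k) -> (forall k, tail_from i d k <= 1) ->
  forall k, 0 <= tail_from i (fun k => Rabs (c k) * Rabs (d k)) k <= tail_from i c k).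
{ intros i c d c0 d0 d1 k; specialize (c0 k); specialize (d0 k); specialize (d1 k).
  unfold tail_from in *; destruct (i <=? k)%nat; [|lra].
  rewrite !Rabs_pos_eq by auto; nra. }
assert (Ta := T _ _ _ a'0 A0 A1); assert (Tb := T _ _ _ b'0 B0 B1); clear T.
set (a2 := tail_from 2 (fun k => Rabs (a k) * Rabs (A k))) in *.
set (b2 := tail_from 1 (fun k => Rabs (b k) * Rabs (B k))) in *.
assert (Sle : forall w c d, (forall k, 0 <= w k) -> (forall k, 0 <= c k <= d k) ->
  disk_summable (fun k => w k * d k) -> disk_summable (fun k => w k * c k)).
{ intros w c d w0 cd; apply disk_summable_le; intros k.
  specialize (w0 k); destruct (cd k).
  rewrite !Rabs_mult, (Rabs_pos_eq (c k)), (Rabs_pos_eq (d k)) by lra.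
  apply Rmult_le_compat_l; auto using Rabs_pos. }
assert (cN0 : forall k, 0 <= cN k) by apply HC.
assert (cM0 : forall k, 0 <= cM k) by (intros k; destruct (HC k); lra).
assert (S1 : forall c d, (forall k, 0 <= c k <= d k) -> disk_summable d -> disk_summable c).
{ intros c d cd; apply disk_summable_le; intros k; destruct (cd k).
  rewrite !Rabs_pos_eq; lra. }
set (sg := - ((-1) ^ n * (-1) ^ (m - 1))) in *.
assert (Hs : Rabs sg <= 1).
{ unfold sg; rewrite Rabs_Ropp, Rabs_mult, !pow_1_abs; lra. }
apply Rabs_le_between in Hs.
(* Monotone in the coefficients because the weight [cM k - eta * s * cN k] is nonnegative; used with
   [s = 1] for the analytic and [s = sg] for the antianalytic part. *)
assert (Q : forall s c d r, -1 <= s <= 1 -> (forall k, 0 <= c k <= d k) ->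
  disk_summable (fun k => cM k * d k) -> disk_summable (fun k => cN k * d k) -> 0 < r < 1 ->
  PSeries (fun k => cM k * c k) r - eta * s * PSeries (fun k => cN k * c k) r <=
  PSeries (fun k => cM k * d k) r - eta * s * PSeries (fun k => cN k * d k) r).
{ intros s c d r Hs1 cd SM SN Hr.
  assert (SMc := Sle cM c d cM0 cd SM); assert (SNc := Sle cN c d cN0 cd SN).
  rewrite <- !(PSeries_scal_fun (eta * s)), <- !PSeries_minus_disk
    by (auto using disk_summable_scal; lra).
  apply PSeries_le; [|auto using disk_summable_minus, disk_summable_scal|lra].
  intros k; specialize (HC k); destruct (cd k).
  assert (W : 0 <= cM k - eta * s * cN k).
  { assert (eta * s <= 1) by nra; nra. }
  nra. }
apply SHbar_of_coeff; auto; fold cM cN a2 b2 sg.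
- lra.
- intros; apply Rmult_le_pos; apply Rabs_pos.
- intros; apply Rmult_le_pos; apply Rabs_pos.
- apply S1 with (2 := Sa), Ta.
- apply S1 with (2 := Sb), Tb.
- apply Sle with (2 := Ta); auto.
- apply Sle with (2 := Tb); auto.
- intros r Hr; apply Rle_lt_trans with (2 := df r Hr).
  assert (Dle : forall c d, (forall k, 0 <= c k <= d k) ->
    forall k, 0 <= PS_derive c k <= PS_derive d k).
  { intros c d cd k; destruct (cd (S k)); assert (K := pos_INR (S k)).
    split; [apply Rmult_le_pos|apply Rmult_le_compat_l]; auto. }
  apply Rplus_le_compat; apply PSeries_le; auto using disk_summable_derive.
- intros r Hr; apply Rle_lt_trans with (2 := qf r Hr).
  apply Rplus_le_compat; [|apply Q; auto].
  assert (Q1 := Q 1 a2 (tail_from 2 a) r ltac:(lra) Ta SMa SNa Hr).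
  rewrite Rmult_1_r in Q1; exact Q1.
Qed.
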